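(* Let $n\ge 23$ and let $c^*=\frac{3n}{4}+\frac{21}{64}$. Define $$f_e(c)=c^3+(2n^2-2n-3)c^2+(-3n^3+3n-1)c+(6n^3-5n^2+2n)+\frac{-3n^3+3n^2}{c},$$ $$f_o(c)=c^3+(2n^2-2n-3)c^2+(-3n^3+6n-1)c+(6n^3-5n^2-4n+3)+\frac{-3n^3+3n^2+3n-3}{c}.$$ Consider the minimum of $\mathcal{K}(G)-\mathcal{K}(T)$ over all trees $T$ on $n$ vertices and all graphs $G$ obtained from $T$ by adding an edge between two non-adjacent vertices. If $n\equiv 0,1,6,7 \pmod 8$, this minimum value equals $$\frac{1}{6n(n-1)}\min\{f_e(\lfloor c^*\rfloor),f_e(\lfloor c^*\rfloor+2),f_o(\lceil c^*\rceil),f_o(\lceil c^*\rceil-2)\}.$$ If $n\equiv 2,3,4,5\pmod 8$, this minimum value equals $$\frac{1}{6n(n-1)}\min\{f_o(\lfloor c^*\rfloor),f_o(\lfloor c^*\rfloor+2),f_e(\lceil c^*\rceil),f_e(\lceil c^*\rceil-2)\}.$$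
   Context: Kemeny's constant: for a connected graph $H$ with adjacency matrix $A$ and diagonal degree matrix $\Delta$, consider the random walk with transition matrix $\Delta^{-1}A$, its stationary distribution $w=(w_k)$ and mean first passage times $m_{j,k}$; then $\mathcal{K}(H)=\sum_{k\neq j} m_{j,k}w_k$, which is independent of $j$. *)

(* Defs.v *)
From HB Require Import structures.
From mathcomp Require Import all_boot all_order all_algebra.
From mathcomp Require Import all_classical all_reals.
From mathcomp Require Import topology normedtype sequences.
Set Implicit Arguments. Unset Strict Implicit. Unset Printing Implicit Defensive.
Import Order.TTheory GRing.Theory Num.Theory.
Import numFieldNormedType.Exports.
Local Open Scope ring_scope.

Definition simple_graph n (e : rel 'I_n) : Prop :=
  (forall x, ~~ e x x) /\ (forall x y, e x y = e y x).

Definition connected_graph n (e : rel 'I_n) : Prop :=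
  forall x y, connect e x y.

Definition acyclic_graph n (e : rel 'I_n) : Prop :=
  ~ exists s : seq 'I_n, [/\ (2 < size s)%N, uniq s & cycle e s].

Definition is_tree n (e : rel 'I_n) : Prop :=
  simple_graph e /\ connected_graph e /\ acyclic_graph e.

Definition add_edge n (e : rel 'I_n) (u v : 'I_n) : rel 'I_n :=
  fun x y => [|| e x y, (x == u) && (y == v) | (x == v) && (y == u)].

Section Kemeny.
Variables (R : realType) (n : nat) (e : rel 'I_n).

Definition deg (x : 'I_n) : R := #|[pred y | e x y]|%:R.

Definition trans_mx : 'M[R]_n := \matrix_(i, j) ((e i j)%:R / deg i).

Definition is_stationary (w : 'rV[R]_n) : Prop :=
  (forall k, 0 <= w 0 k) /\ \sum_k w 0 k = 1 /\ w *m trans_mx = w.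

Definition taboo_mx (k : 'I_n) : 'M[R]_n :=
  \matrix_(i, j) (if j == k then 0 else trans_mx i j).

Definition first_passage_prob (j k : 'I_n) (t : nat) : R :=
  ((taboo_mx k ^+ t.-1) *m trans_mx) j k.

Definition mfpt (j k : 'I_n) : R :=
  limn (fun N => \sum_(1 <= t < N) (t%:R * first_passage_prob j k t)).

(* Kemeny's constant: sum_{k <> j} m_{j,k} w_k, with w the stationary
   distribution; it is independent of j (the defining set below is the
   singleton {K(H)} for connected H). *)
Definition kemeny : R :=
  xget 0 [set K | exists w, is_stationary w /\
            forall j, K = \sum_(k | k != j) mfpt j k * w 0 k].
End Kemeny.

Definition f_e (R : realType) (n : nat) (c : R) : R :=
  let m : R := n%:R in
  c ^+ 3 + (2 * m ^+ 2 - 2 * m - 3) * c ^+ 2 + (- 3 * m ^+ 3 + 3 * m - 1) * c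
  + (6 * m ^+ 3 - 5 * m ^+ 2 + 2 * m) + (- 3 * m ^+ 3 + 3 * m ^+ 2) / c.

Definition f_o (R : realType) (n : nat) (c : R) : R :=
  let m : R := n%:R in
  c ^+ 3 + (2 * m ^+ 2 - 2 * m - 3) * c ^+ 2 + (- 3 * m ^+ 3 + 6 * m - 1) * c
  + (6 * m ^+ 3 - 5 * m ^+ 2 - 4 * m + 3)
  + (- 3 * m ^+ 3 + 3 * m ^+ 2 + 3 * m - 3) / c.

Definition cstar (R : realType) (n : nat) : R := 3 * n%:R / 4 + 21 / 64.

Definition min4 (R : realType) (a b c d : R) : R :=
  Num.min (Num.min a b) (Num.min c d).

Definition claimed_min (R : realType) (n : nat) : R :=
  let fl := Num.floor (cstar R n) in
  let ce := Num.ceil (cstar R n) in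
  let z (k : int) : R := k%:~R in
  (6 * n%:R * (n%:R - 1))^-1 *
  (if (n %% 8 \in [:: 0; 1; 6; 7])%N then
     min4 (f_e n (z fl)) (f_e n (z (fl + 2))) (f_o n (z ce)) (f_o n (z (ce - 2)))
   else
     min4 (f_o n (z fl)) (f_o n (z (fl + 2))) (f_e n (z ce)) (f_e n (z (ce - 2)))).

(* Main.v *)
Require Import Defs.
From HB Require Import structures.
From mathcomp Require Import all_boot all_order all_algebra.
From mathcomp Require Import all_classical all_reals.
From mathcomp Require Import topology normedtype sequences.
From mathcomp Require Import ring lra zify.
Set Implicit Arguments. Unset Strict Implicit. Unset Printing Implicit Defensive.
Import Order.TTheory GRing.Theory Num.Theory.
Import numFieldNormedType.Exports.
Local Open Scope ring_scope.

(** For a connected graph with resistance matrix [rho], degrees [d] and volume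
    [vol], the mean first passage times are
    [m_jk = 1/2 sum_z d_z (rho_jk + rho_kz - rho_jz)], so that Kemeny's constant
    is [sum_jk d_j d_k rho_jk / (2 vol)].  In a tree [rho] is the distance [D];
    after closing the path from [u] to [v] into a cycle of length [c] it is
    [D_xy - (p_x - p_y)^2 / c], where [p_x] is the position on the path of the
    vertex at which [x] is attached.  Writing [h_x] for the distance from [x] to
    the path, [6 n (n - 1)] times the change of Kemeny's constant is
    - [6 sum_(x <> y) (h_x + h_y + |p_x - p_y| - D_xy)], which is nonnegative and
      vanishes when all branches are stars centred on the path;
    - plus [3 (n - 1) (c (2 n + 1) - 2 n)];
    - minus [6 sum_xy (|p_x - p_y| + (n - 1) (p_x - p_y)^2 / c)], where every
      position occurs; by convexity this is extremal when the [n - c] vertices off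
      the path are split evenly between its two ends.
    For given [c] the minimum is thus [f_e c] or [f_o c], according to the parity
    of [n - c].  Along each parity class these values decrease up to the neighbours
    of [c^*] and increase beyond them. *)

(** * First passage times *)

Lemma deg_sum (R : realType) n (e : rel 'I_n) j : deg R e j = \sum_l (e j l)%:R.
Proof.
rewrite /deg -sum1_card natr_sum big_mkcond; apply: eq_bigr => l _.
by rewrite unfold_in; case: (e j l).
Qed.

Lemma trans_mx_sum (R : realType) n (e : rel 'I_n) j :
  deg R e j != 0 -> \sum_l trans_mx R e j l = 1.
Proof.
move=> dj; rewrite -(divff dj) {1}deg_sum mulr_suml.
by apply: eq_bigr => l _; rewrite mxE.
Qed.

Section GeometricDecay.
Local Open Scope classical_set_scope.

(** With s the square root of z, N z^N = (N s^N) s^N, and the first factor is bounded by 1 / (1 - s)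
    through the geometric sum. *)
Lemma cvg_natmul_expr (R : realType) (z : R) : 0 <= z -> z < 1 ->
  (fun N : nat => N%:R * z ^+ N) @ \oo --> (0 : R).
Proof.
move=> z0 z1; pose s := Num.sqrt z.
have s0 : 0 <= s by rewrite sqrtr_ge0.
have s2 : s ^+ 2 = z by rewrite sqr_sqrtr.
have s1 : s < 1 by rewrite -(ltr_pXn2r (n := 2)) ?nnegrE // expr1n s2.
have bound (N : nat) : N%:R * s ^+ N * (1 - s) <= 1.
  have -> : N%:R * s ^+ N * (1 - s) = (1 - s) * \sum_(i < N) s ^+ N.
    by rewrite sumr_const card_ord -mulr_natl; ring.
  apply: (@le_trans _ _ ((1 - s) * \sum_(i < N) s ^+ i)).
    rewrite ler_wpM2l ?subr_ge0 ?(ltW s1) //; apply: ler_sum => i _.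
    by apply: ler_wiXn2l => //; [exact: ltW|exact/ltnW].
  by rewrite -opprB mulNr -subrX1 opprB gerBl exprn_ge0.
have lim : (fun N : nat => (1 - s)^-1 * s ^+ N) @ \oo --> (0 : R).
  by apply: cvg_geometric; rewrite ger0_norm.
apply: (squeeze_cvgr _ (cvg_cst 0) lim); apply: nearW => N.
rewrite mulr_ge0 ?exprn_ge0 //= -s2 -exprM mulnC exprM expr2.
rewrite mulrA ler_wpM2r ?exprn_ge0 //.
by rewrite -div1r ler_pdivlMr ?subr_gt0.
Qed.

End GeometricDecay.

Section MeanFirstPassage.
Local Open Scope classical_set_scope.
Variables (R : realType) (n : nat) (e : rel 'I_n) (k : 'I_n).
Hypothesis deg_neq0 : forall j, deg R e j != 0.
Let P := trans_mx R e.
Let B := taboo_mx R e k.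
Let one : 'cV[R]_n := const_mx 1.

Lemma taboo_col : col k P = one - B *m one.
Proof.
apply/colP => j.
have Bone : (B *m one) j 0 = \sum_(l | l != k) P j l.
  rewrite mxE (bigD1 k) //= !mxE eqxx mul0r add0r.
  by apply: eq_bigr => l /negPf lk; rewrite !mxE lk mulr1.
have -> : (one - B *m one) j 0 = 1 - (B *m one) j 0 by rewrite !mxE.
by rewrite Bone -(trans_mx_sum (deg_neq0 j)) (bigD1 k) //= addrK mxE.
Qed.

(** The entry of [B ^+ t *m one] at [j] is the probability that [k] is not visited in steps 1, ...,
    t of the walk from [j]. *)
Lemma first_passage_probE j t :
  first_passage_prob R e j k t.+1 = (B ^+ t *m one) j 0 - (B ^+ t.+1 *m one) j 0.
Proof.
rewrite /first_passage_prob /=.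
have -> : (B ^+ t *m P) j k = (B ^+ t *m col k P) j 0.
  by rewrite !mxE; apply: eq_bigr => i _; rewrite !mxE.
by rewrite taboo_col mulmxBr mulmxA exprSr !mxE.
Qed.

Lemma partial_mfpt j N :
  \sum_(1 <= t < N.+1) t%:R * first_passage_prob R e j k t =
  \sum_(t < N) (B ^+ t *m one) j 0 - N%:R * (B ^+ N *m one) j 0.
Proof.
elim: N => [|N IH]; first by rewrite big_geq // big_ord0 mul0r subr0.
rewrite big_nat_recr //= IH big_ord_recr /= first_passage_probE -natr1.
ring.
Qed.

Variable h : 'I_n -> R.
Hypothesis h_ge0 : forall j, 0 <= h j.
Hypothesis h_eq : forall j, h j = 1 + \sum_(l | l != k) P j l * h l.
Let hv : 'cV[R]_n := \col_j h j.

Lemma hv_eq : hv = one + B *m hv.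
Proof.
apply/colP => j; rewrite !mxE h_eq; congr (_ + _).
rewrite [RHS](bigD1 k) //= !mxE eqxx mul0r add0r.
by apply: eq_bigr => l /negPf lk; rewrite !mxE lk.
Qed.

Lemma sum_taboo j N :
  \sum_(t < N) (B ^+ t *m one) j 0 = h j - (B ^+ N *m hv) j 0.
Proof.
elim: N => [|N IH]; first by rewrite big_ord0 expr0 mul1mx mxE subrr.
rewrite big_ord_recr /= IH {1}hv_eq mulmxDr mulmxA exprSr !mxE; ring.
Qed.

Lemma taboo_ge0 t i j : 0 <= (B ^+ t) i j.
Proof.
have B0 a b : 0 <= B a b.
  by rewrite !mxE; case: ifP => // _; rewrite divr_ge0 ?ler0n.
elim: t i j => [|t IH] i j; first by rewrite expr0 mxE ler0n.
by rewrite exprS mxE sumr_ge0 // => l _; rewrite mulr_ge0.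
Qed.

Let M := 1 + \sum_j h j.
Let r := 1 - M^-1.

Lemma bound_ge1 : 1 <= M.
Proof. by rewrite /M lerDl sumr_ge0. Qed.

Lemma taboo_hv_le j N : (B ^+ N *m hv) j 0 <= r ^+ N * h j.
Proof.
have M0 : 0 < M by apply: lt_le_trans bound_ge1.
have hM l : h l <= M.
  rewrite /M (bigD1 l) //=; have : 0 <= \sum_(i | i != l) h i by apply: sumr_ge0.
  lra.
elim: N => [|N IH]; first by rewrite !expr0 mul1mx mxE mul1r.
have step : (B ^+ N *m (B *m hv)) j 0 <= (B ^+ N *m (r *: hv)) j 0.
  rewrite [leLHS]mxE [leRHS]mxE; apply: ler_sum => l _.
  rewrite ler_wpM2l ?taboo_ge0 //.
  have /colP/(_ l) := hv_eq; rewrite [RHS]mxE [in LHS]mxE [one _ _]mxE => hl.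
  rewrite [leRHS]mxE [hv _ _]mxE.
  have -> : (B *m hv) l 0 = h l - 1 by rewrite [in RHS]hl; ring.
  rewrite mulrBl mul1r lerD2l lerN2 mulrC ler_pdivrMr // mul1r; exact: hM.
have -> : B ^+ N.+1 *m hv = B ^+ N *m (B *m hv) by rewrite mulmxA exprSr.
apply: le_trans step _.
rewrite -scalemxAr mxE exprS -mulrA ler_wpM2l //.
by rewrite subr_ge0 invf_le1 // bound_ge1.
Qed.

(* Since [h >= 1] is bounded, [B h = h - 1] contracts [h] by the factor [r < 1],
   which makes the defining series converge geometrically. *)
Lemma mfpt_solution j : mfpt R e j k = h j.
Proof.
have M0 : 0 < M by apply: lt_le_trans bound_ge1.
have r0 : 0 <= r by rewrite subr_ge0 invf_le1 // bound_ge1.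
have r1 : r < 1 by rewrite gtrBl invr_gt0.
apply/cvg_lim => //; rewrite -(cvg_shiftn 1).
under eq_fun do rewrite addn1 partial_mfpt sum_taboo.
have one_le N : 0 <= (B ^+ N *m one) j 0 <= (B ^+ N *m hv) j 0.
  rewrite !mxE; apply/andP; split.
    by apply: sumr_ge0 => l _; rewrite mulr_ge0 ?taboo_ge0 // mxE ler01.
  apply: ler_sum => l _; rewrite ler_wpM2l ?taboo_ge0 // !mxE h_eq lerDl.
  by apply: sumr_ge0 => i _; rewrite mulr_ge0 // mxE divr_ge0 ?ler0n.
have lim : (fun N : nat => h j * (r ^+ N + N%:R * r ^+ N)) @ \oo --> (0 : R).
  rewrite -(mulr0 (h j)) -[X in _ * X](addr0 0).
  apply: cvgM; first exact: cvg_cst.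
  by apply: cvgD; [apply: cvg_expr; rewrite ger0_norm|exact: cvg_natmul_expr].
have low : (fun N : nat => h j - h j * (r ^+ N + N%:R * r ^+ N)) @ \oo --> h j.
  by rewrite -[X in _ --> X]subr0; apply: cvgB => //; exact: cvg_cst.
apply: (squeeze_cvgr _ low (cvg_cst (h j))); apply: nearW => N /=.
have /andP[b0 bh] := one_le N; have bN := taboo_hv_le j N.
have N0 : 0 <= N%:R :> R by [].
have Nb0 := mulr_ge0 N0 b0.
apply/andP; split; last by lra.
suff : N%:R * (B ^+ N *m one) j 0 <= N%:R * (r ^+ N * h j) by lra.
by rewrite ler_wpM2l //; exact: le_trans bN.
Qed.
End MeanFirstPassage.

(** * Kemeny's constant from resistances *)

Section ResistanceMatrix.
Variables (R : realType) (n : nat) (e : rel 'I_n).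
Variables (rho : 'I_n -> 'I_n -> R) (tau : 'I_n -> R).
Hypothesis e_sym : symmetric e.
Hypothesis deg_neq0 : forall j, deg R e j != 0.
Hypothesis rho_diag : forall k, rho k k = 0.
Hypothesis laplacian_rho : forall j k,
  \sum_l (e j l)%:R * (rho j k - rho l k) = tau j - 2 * (j == k)%:R.
Let d := deg R e.
Let vol := \sum_j d j.

Definition hitting_time j k : R :=
  2^-1 * \sum_z d z * (rho j k + rho k z - rho j z).

Lemma hitting_time_diag k : hitting_time k k = 0.
Proof.
rewrite /hitting_time big1 ?mulr0 // => z _.
by rewrite rho_diag add0r subrr mulr0.
Qed.

(** The term [tau j] cancels between the columns [k] and [z] of [rho], leaving only the two
    Kronecker terms. *)
Lemma laplacian_hitting_time j k :
  \sum_l (e j l)%:R * (hitting_time j k - hitting_time l k) =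
  d j - (j == k)%:R * vol.
Proof.
have -> : \sum_l (e j l)%:R * (hitting_time j k - hitting_time l k) =
    \sum_z 2^-1 * d z * (\sum_l (e j l)%:R * (rho j k - rho l k) -
                         \sum_l (e j l)%:R * (rho j z - rho l z)).
  under [RHS]eq_bigr => z _ do rewrite -sumrB mulr_sumr.
  rewrite exchange_big /=; apply: eq_bigr => l _.
  rewrite /hitting_time -mulrBr -sumrB !mulr_sumr.
  by apply: eq_bigr => z _; ring.
under eq_bigr => z _ do rewrite !laplacian_rho.
rewrite (eq_bigr (fun z => (z == j)%:R * d z - (j == k)%:R * d z)); last first.
  by move=> z _; rewrite (eq_sym z j); field.
rewrite sumrB -mulr_sumr; congr (_ - _).
rewrite (bigD1 j) //= eqxx mul1r big1 ?addr0 // => z /negPf ->.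
by rewrite mul0r.
Qed.

Lemma hitting_time_eq j k : j != k ->
  hitting_time j k = 1 + \sum_(l | l != k) trans_mx R e j l * hitting_time l k.
Proof.
move=> /negPf jk.
have := laplacian_hitting_time j k; rewrite jk mul0r subr0.
under eq_bigr => l _ do rewrite mulrBr.
rewrite sumrB -mulr_suml -deg_sum [in X in _ - X](bigD1 k) //=.
rewrite hitting_time_diag mulr0 add0r => H.
have -> : \sum_(l | l != k) trans_mx R e j l * hitting_time l k =
   (\sum_(l | l != k) (e j l)%:R * hitting_time l k) / d j.
  by rewrite mulr_suml; apply: eq_bigr => l _; rewrite mxE mulrAC.
apply: (mulfI (deg_neq0 j)); rewrite mulrDr mulr1.
by rewrite [X in _ + X]mulrC divfK // -[X in _ = X + _]H subrK.
Qed.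

(** Minimum principle: if the minimum over [j] were attained at some [i] other than [k], the
    first-step equation would make it exceed itself by 1. *)
Lemma hitting_time_ge0 j k : 0 <= hitting_time j k.
Proof.
case: (@arg_minP _ R _ k xpredT (hitting_time^~ k) isT) => i _ imin.
suff -> : 0 = hitting_time i k by exact: imin.
have [->|ik] := eqVneq i k; first by rewrite hitting_time_diag.
have Pge0 l : 0 <= trans_mx R e i l by rewrite mxE divr_ge0 ?ler0n.
have : 1 + \sum_l trans_mx R e i l * hitting_time i k <= hitting_time i k.
  rewrite [leRHS]hitting_time_eq // lerD2l [leRHS](_ : _ =
    \sum_l trans_mx R e i l * hitting_time l k); last first.
    by rewrite [RHS](bigD1 k) //= hitting_time_diag mulr0 add0r.
  by apply: ler_sum => l _; rewrite ler_wpM2l // imin.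
by rewrite -mulr_suml trans_mx_sum //; lra.
Qed.

Lemma mfpt_hitting_time j k : j != k -> mfpt R e j k = hitting_time j k.
Proof.
(* [mfpt_solution] wants the first-step equation at [k] too, where [hitting_time] is 0; the mean
   return time takes its place there. *)
move=> jk; pose h i := if i == k
  then 1 + \sum_(l | l != k) trans_mx R e i l * hitting_time l k
  else hitting_time i k.
have Pge0 i l : 0 <= trans_mx R e i l by rewrite mxE divr_ge0 ?ler0n.
rewrite (@mfpt_solution _ _ _ k deg_neq0 h); first by rewrite /h (negPf jk).
- move=> i; rewrite /h; case: ifP => _; rewrite ?hitting_time_ge0 //.
  by rewrite addr_ge0 // sumr_ge0 // => l _; rewrite mulr_ge0 // hitting_time_ge0.
move=> i; have -> : h i = 1 + \sum_(l | l != k) trans_mx R e i l * hitting_time l k.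
  by rewrite /h; case: ifPn => // /hitting_time_eq.
by congr (_ + _); apply: eq_bigr => l /negPf lk; rewrite /h lk.
Qed.

(* Pairing the invariance of [w / deg] with the columns of [rho] forces
   [w / deg] to be constant. *)
Lemma stationary_unique (w : 'rV[R]_n) k : is_stationary e w -> w 0 k = d k / vol.
Proof.
move=> [_ [w1 wP]]; pose g j := w 0 j / d j.
have dg j : d j * g j = w 0 j by rewrite mulrCA divff ?mulr1.
have inv l : \sum_j g j * (e j l)%:R = w 0 l.
  rewrite -[in RHS]wP mxE; apply: eq_bigr => j _.
  by rewrite mxE /g mulrAC mulrA.
have g_const i : 2 * g i = \sum_j g j * tau j.
  have : \sum_j g j * (\sum_l (e j l)%:R * (rho j i - rho l i)) = 0.
    have -> : \sum_j g j * (\sum_l (e j l)%:R * (rho j i - rho l i)) =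
        \sum_j (w 0 j * rho j i) -
        \sum_l (\sum_j g j * (e j l)%:R) * rho l i.
      under [X in _ = _ - X]eq_bigr => l _ do rewrite mulr_suml.
      rewrite exchange_big /= -sumrB; apply: eq_bigr => j _.
      rewrite -dg /d deg_sum !mulr_suml -sumrB mulr_sumr.
      by apply: eq_bigr => l _; ring.
    by under [X in _ - X]eq_bigr => l _ do rewrite inv; rewrite subrr.
  under eq_bigr => j _ do rewrite laplacian_rho mulrBr.
  rewrite sumrB => /eqP; rewrite subr_eq0 => /eqP ->.
  rewrite (bigD1 i) //= eqxx big1 => [|j /negPf ->]; last by rewrite !mulr0.
  by rewrite addr0 mulr1 mulrC.
have gE j : g j = g k.
  have := g_const j; have := g_const k => <-; lra.
have gvol : g k * vol = 1.
  by rewrite -w1 mulr_sumr; apply: eq_bigr => j _; rewrite -dg (gE j) mulrC.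
have vol0 : vol != 0.
  by apply/eqP => v0; move: gvol; rewrite v0 mulr0 => /eqP; rewrite eq_sym oner_eq0.
by rewrite -dg -[X in _ = X]mulr1 -gvol; field.
Qed.

Lemma stationary_deg : (0 < n)%N -> is_stationary e (\row_j (d j / vol)).
Proof.
move=> n0.
have dgt0 j : 0 < d j by rewrite lt_neqAle eq_sym deg_neq0 /d /deg ler0n.
have vgt0 : 0 < vol.
  rewrite /vol (bigD1 (Ordinal n0)) //= ltr_wpDr // sumr_ge0 // => j _; exact/ltW.
split=> [k|]; first by rewrite mxE divr_ge0 // ltW.
split; first by under eq_bigr => j _ do rewrite mxE; rewrite -mulr_suml divff ?gt_eqF.
apply/rowP => k; rewrite !mxE {2}/d deg_sum mulr_suml; apply: eq_bigr => j _.
by rewrite !mxE e_sym -/(d j); field; rewrite ?deg_neq0 ?gt_eqF.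
Qed.

Lemma sum_hitting_time j : vol != 0 ->
  \sum_(k | k != j) hitting_time j k * (d k / vol) =
  (\sum_i \sum_k d i * d k * rho i k) / (2 * vol).
Proof.
move=> vol0.
have -> : \sum_(k | k != j) hitting_time j k * (d k / vol) =
          \sum_k hitting_time j k * (d k / vol).
  by rewrite [RHS](bigD1 j) //= hitting_time_diag mul0r add0r.
have -> : \sum_k hitting_time j k * (d k / vol) =
  (\sum_k \sum_z (d k * d z * rho j k + d z * d k * rho k z - d z * d k * rho j z))
    / (2 * vol).
  rewrite mulr_suml; apply: eq_bigr => k _.
  rewrite /hitting_time mulr_sumr !mulr_suml; apply: eq_bigr => z _.
  by field.
congr (_ / _).
under eq_bigr => k _ do rewrite sumrB big_split /=.
rewrite sumrB big_split /= [X in _ - X]exchange_big /=.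
rewrite addrAC subrr add0r.
by apply: eq_bigr => k _; apply: eq_bigr => z _; rewrite [d z * _]mulrC.
Qed.

Lemma kemeny_resistance : (0 < n)%N ->
  kemeny R e = (\sum_j \sum_k d j * d k * rho j k) / (2 * vol).
Proof.
move=> n0; have [_ [w1 _]] := stationary_deg n0.
have vol0 : vol != 0.
  apply/eqP => v0; move: w1; under eq_bigr => j _ do rewrite mxE v0 invr0 mulr0.
  by rewrite big1 // => /eqP; rewrite eq_sym oner_eq0.
have sumE (w : 'rV[R]_n) j : is_stationary e w ->
    \sum_(k | k != j) mfpt R e j k * w 0 k =
    (\sum_i \sum_k d i * d k * rho i k) / (2 * vol).
  move=> ws; rewrite -(sum_hitting_time j) //; apply: eq_bigr => k kj.
  by rewrite mfpt_hitting_time 1?eq_sym // (stationary_unique k ws).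
apply: xget_unique => [|y [w [ws yE]]].
  by exists (\row_j (d j / vol)); split=> [|j]; [|rewrite sumE //]; exact: stationary_deg.
by rewrite (yE (Ordinal n0)) sumE.
Qed.
End ResistanceMatrix.

(** * Tree metrics *)

(** The facts on tree distances used below, stated without paths: across an edge every distance
    changes by exactly one, and every vertex but the target has exactly one neighbour closer to
    it. *)
Record tree_metric n (e : rel 'I_n) (D : 'I_n -> 'I_n -> nat) : Prop := TreeMetric {
  tm_adj_sym : symmetric e;
  tm_sym : forall x y, D x y = D y x;
  tm_xx : forall x, D x x = 0%N;
  tm_edge : forall x y z, e x y -> D x z = (D y z).+1 \/ D y z = (D x z).+1;
  tm_step : forall x y, x != y -> exists2 z, e x z & D x y = (D z y).+1;
  tm_uniq : forall x y z z', e x z -> e x z' ->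
    (D z y < D x y)%N -> (D z' y < D x y)%N -> z = z' }.

Section TreeMetricTheory.
Variables (n : nat) (e : rel 'I_n) (D : 'I_n -> 'I_n -> nat).
Hypothesis tmD : tree_metric e D.
Let sym := tm_sym tmD.
Let xx := tm_xx tmD.
Let edge := tm_edge tmD.
Let step := tm_step tmD.

Lemma tm_eq0 x y : D x y = 0%N -> x = y.
Proof.
by move=> D0; apply/eqP; apply/negPn/negP => /step [z _]; rewrite D0.
Qed.

Lemma tm_triangle x y z : (D x z <= D x y + D y z)%N.
Proof.
have [m] := ubnP (D x y); elim: m x => // m IH x xy.
have [->|nxy] := eqVneq x y; first by rewrite xx.
have [w xw wE] := step nxy.
have /IH : (D w y < m)%N by lia.
have := edge z xw; lia.
Qed.

(** The edge from [x] to [x'] separates [u] from [y], so a geodesic between them crosses it.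
    Induction on the distance from [y] to [x']. *)
Lemma tm_bridge x x' u y : e x x' -> (D x' y < D x y)%N -> (D x u < D x' u)%N ->
  D u y = (D u x + D x' y).+1.
Proof.
move=> xx'; have [m] := ubnP (D x' y); elim: m y => // m IH y ym yx' xu.
have x'u : D u x' = (D u x).+1 by have := edge u xx'; rewrite ![D u _]sym; lia.
have [->|ny] := eqVneq y x'; first by rewrite xx addn0.
have [z yz zE] := step ny; rewrite ![D _ x']sym in zE.
have zx : (D x' z < D x z)%N by have := edge x yz; rewrite ![D _ x]sym; lia.
have uz : D u z = (D u x + D x' z).+1 by apply: IH => //; lia.
have := edge u yz; rewrite ![D _ u]sym => -[|zy]; first by lia.
(* [y] would be the neighbour of [z] towards [u], which lies on the [x'] side of [z] *)
have [w [zw wu wy]] : exists w, [/\ e z w, (D w u < D z u)%N & w <> y].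
  have [zx'|nz] := eqVneq z x'.
    exists x; split; rewrite ?zx' 1?(tm_adj_sym tmD) //.
    by move=> xy; move: yx'; rewrite xy xx.
  have [w zw wE] := step nz; rewrite ![D _ x']sym in wE.
  exists w; split=> //; last by move=> wy; move: wE zE; rewrite wy; lia.
  have wx : (D x' w < D x w)%N by have := edge x zw; rewrite ![D _ x]sym; lia.
  by rewrite ![D _ u]sym uz (IH w) //; lia.
case: wy; apply: (tm_uniq tmD zw _ wu); first by rewrite (tm_adj_sym tmD).
by rewrite ![D _ u]sym; lia.
Qed.

(* The four-point condition, by moving [x] one step towards [y] at a time. *)
Lemma tm_four_point x y u v :
  (D x y + D u v <= maxn (D x u + D y v) (D x v + D y u))%N.
Proof.
have [m] := ubnP (D x y); elim: m x => // m IH x xm.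
have [->|nxy] := eqVneq x y.
  have := tm_triangle u y v; rewrite xx [D u y]sym; lia.
have [w xw wE] := step nxy.
have wy : (D w y < D x y)%N by lia.
have IHw := IH w ltac:(lia).
have uxv := tm_triangle u x v; rewrite (sym u x) in uxv.
case: (edge u xw) => xuE; last first.
  have := tm_bridge xw wy (u := u) ltac:(lia); rewrite (sym u y) (sym u x); lia.
case: (edge v xw) => xvE; last first.
  have := tm_bridge xw wy (u := v) ltac:(lia); rewrite (sym v y) (sym v x); lia.
lia.
Qed.

(** The default [x] is returned only at the root [k]. *)
Definition parent k x := odflt x [pick z | e x z && (D z k < D x k)%N].

Lemma parentP k x : x != k -> e x (parent k x) /\ D x k = (D (parent k x) k).+1.
Proof.
move=> xk; rewrite /parent; case: pickP => [z /andP[xz zk]|no] /=.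
  by split=> //; have := edge k xz; lia.
by have [z xz zE] := step xk; have := no z; rewrite xz zE ltnSn.
Qed.

Lemma closer_parent k x z : e x z && (D z k < D x k)%N = (x != k) && (z == parent k x).
Proof.
apply/andP/andP => [[xz zk]|[xk /eqP ->]]; last first.
  by have [-> ->] := parentP xk; rewrite ltnSn.
have xk : x != k by apply: contraTneq zk => ->; rewrite xx.
split=> //; have [xp pE] := parentP xk.
by apply/eqP; apply: (tm_uniq tmD xz xp zk); rewrite pE.
Qed.

Variables u v : 'I_n.

(* [x] hangs at distance [height x] from the vertex number [pos x] of the path
   from [u] to [v]; both halves are exact. *)
Definition pos x := (D x u + D u v - D x v)./2.
Definition height x := (D x u + D x v - D u v)./2.

(** Crossing an edge changes [D x u] and [D x v] by one each, so [D x u + D x v + D u v] keeps the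
    even parity it has at [x = u]; the triangle inequalities make the truncated subtractions
    exact. *)
Lemma pos_heightP x :
  [/\ D x u = (pos x + height x)%N, (pos x <= D u v)%N &
      (D x v + pos x = D u v + height x)%N].
Proof.
have even : ~~ odd (D x u + D x v + D u v).
  have [m] := ubnP (D x u); elim: m x => // m IH x xm.
  have [->|xu] := eqVneq x u; first by rewrite xx; lia.
  have [z xz zE] := step xu; have /IH : (D z u < m)%N by lia.
  have := edge v xz; lia.
have := tm_triangle x u v; have := tm_triangle u x v.
have := tm_triangle x v u; rewrite (sym u x) (sym v u) /pos /height; split; lia.
Qed.

Lemma pos_source : pos u = 0%N.
Proof. by have := pos_heightP u; rewrite xx => -[]; lia. Qed.

Lemma pos_target : pos v = D u v.
Proof. by have := pos_heightP v; rewrite xx => -[]; lia. Qed.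

(** As a + b - 2 min(a, b) = |a - b|, this bounds the distance by h_x + h_y + |p_x - p_y|, which
    makes [metric_excess] nonnegative. *)
Lemma tm_le_height x y :
  (D x y + minn (pos x) (pos y) + minn (pos x) (pos y) <=
   height x + height y + pos x + pos y)%N.
Proof.
have := tm_four_point x y u v.
have [] := pos_heightP x; have [] := pos_heightP y; lia.
Qed.

(** If the step to the parent also leads closer to [v], it stays within the branch; otherwise the
    edge separates [u] from [v], and [tm_bridge] puts both its ends on the path. *)
Lemma pos_parent x : x != u ->
  if height x == 0%N then
    (height (parent u x) == 0%N) && (pos x == (pos (parent u x)).+1)
  else pos (parent u x) == pos x.
Proof.
move=> xu; have [xp pE] := parentP xu.
have [h1 h2 h3] := pos_heightP x; have [p1 p2 p3] := pos_heightP (parent u x).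
case: (edge v xp) => vE.
  have hx : height x = (height (parent u x)).+1 by lia.
  by rewrite hx /=; apply/eqP; lia.
have px : e (parent u x) x by rewrite (tm_adj_sym tmD).
have := tm_bridge px (y := v) (u := u) ltac:(lia) ltac:(lia).
rewrite (sym u (parent u x)) => uvE.
have hx : height x = 0%N by lia.
by rewrite hx eqxx; apply/andP; split; apply/eqP; lia.
Qed.

(** Induction from [u]: the two vertices have parents at the same position, hence the same parent,
    whose neighbour closer to [v] is unique. *)
Lemma pos_inj x y : height x = 0%N -> height y = 0%N -> pos x = pos y -> x = y.
Proof.
have [m] := ubnP (pos x); elim: m x y => // m IH x y xm hx hy pxy.
have [h1 h2 h3] := pos_heightP x; have [p1 p2 p3] := pos_heightP y.
have [xu|xu] := eqVneq x u.
  by move: pxy hx h1; rewrite xu xx => *; apply/esym/tm_eq0; lia.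
have yu : y != u.
  by apply/eqP => yu; case/eqP: xu; apply: tm_eq0; move: pxy hy p1; rewrite yu xx => *; lia.
have := pos_parent xu; have := pos_parent yu; rewrite hx hy !eqxx.
move=> /andP[/eqP hy' /eqP py'] /andP[/eqP hx' /eqP px'].
have pp : parent u x = parent u y by apply: IH => //; lia.
have [xp xpE] := parentP xu; have [yp ypE] := parentP yu.
have [q1 q2 q3] := pos_heightP (parent u x).
have ex : e (parent u x) x by rewrite (tm_adj_sym tmD).
have ey : e (parent u x) y by rewrite pp (tm_adj_sym tmD).
apply: (tm_uniq tmD ex ey (y := v)).
  lia.
lia.
Qed.

Lemma pos_surj i : (i <= D u v)%N -> exists2 x, height x = 0%N & pos x = i.
Proof.
elim: i => [|i IH] iuv.
  exists u; last exact: pos_source.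
  by have [+ _ _] := pos_heightP u; rewrite xx; lia.
have [|x hx px] := IH; first lia.
have [h1 h2 h3] := pos_heightP x.
have xv : x != v by apply/eqP => xv; move: hx px h3; rewrite xv xx; lia.
have [z xz zE] := step xv; exists z.
  have := edge u xz; have := pos_heightP z => -[]; lia.
have := edge u xz; have := pos_heightP z => -[]; lia.
Qed.
End TreeMetricTheory.

(** * Degree sums and the Laplacian of a tree *)

Lemma sum_delta (R : realType) n (w : 'I_n) (F : 'I_n -> R) :
  \sum_x (x == w)%:R * F x = F w.
Proof.
rewrite (bigD1 w) //= eqxx mul1r big1 ?addr0 // => x /negPf ->.
by rewrite mul0r.
Qed.

Section TreeLaplacian.
Variables (R : realType) (n : nat) (e : rel 'I_n) (D : 'I_n -> 'I_n -> nat).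
Hypothesis tmD : tree_metric e D.
Let d := deg R e.
Let Dr x y : R := (D x y)%:R.

Lemma sum_closer (k x : 'I_n) (F : 'I_n -> R) :
  \sum_(z | e x z && (D z k < D x k)%N) F z = (x != k)%:R * F (parent e D k x).
Proof.
under eq_bigl => z do rewrite (closer_parent tmD).
case: (x != k); last by rewrite big_pred0 ?mul0r.
by rewrite big_pred1_eq mul1r.
Qed.

(* Every edge joins exactly one vertex other than [k] to its parent. *)
Lemma tree_edge_sum (k : 'I_n) (g : 'I_n -> R) :
  \sum_x d x * g x = \sum_(x | x != k) (g x + g (parent e D k x)).
Proof.
have -> : \sum_(x | x != k) (g x + g (parent e D k x)) =
    \sum_x \sum_(z | e x z && (D z k < D x k)%N) (g x + g z).
  by rewrite big_mkcond; apply: eq_bigr => x _; rewrite sum_closer mulr_natl; case: eqP.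
under [RHS]eq_bigr => x _ do rewrite big_split /=.
rewrite big_split /= [X in _ + X](exchange_big_dep xpredT) //= -big_split /=.
apply: eq_bigr => x _; rewrite /d deg_sum mulr_suml.
rewrite [LHS](eq_bigr (fun z => if e x z then g x else 0)); last first.
  by move=> z _; case: (e x z); rewrite ?mul1r ?mul0r.
rewrite -big_mkcond /= (bigID (fun z => (D z k < D x k)%N)) /=; congr (_ + _).
apply: eq_bigl => z; rewrite (tm_adj_sym tmD z x).
by case xz: (e x z) => //=; have := tm_edge tmD k xz; lia.
Qed.

Lemma sum_neq_const (k : 'I_n) (a : R) : \sum_(x | x != k) a = (n%:R - 1) * a.
Proof.
have : \sum_(x < n) a = a + \sum_(x < n | x != k) a by rewrite (bigD1 k).
rewrite sumr_const card_ord => nE.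
by rewrite mulrBl mul1r mulr_natl nE addrAC subrr add0r.
Qed.

Lemma sum_tree_deg (k : 'I_n) : \sum_x d x = 2 * (n%:R - 1).
Proof.
have := tree_edge_sum k (fun _ => 1); rewrite sum_neq_const.
by under eq_bigr => x _ do rewrite mulr1; move=> ->; ring.
Qed.

Lemma sum_tree_deg_dist k : \sum_x d x * Dr x k = 2 * \sum_x Dr x k - (n%:R - 1).
Proof.
rewrite (tree_edge_sum k) (eq_bigr (fun x => 2 * Dr x k - 1)); last first.
  move=> x xk; have [_ E] := parentP tmD xk.
  by rewrite /Dr E -natr1; ring.
rewrite sumrB sum_neq_const mulr1 -mulr_sumr [in RHS](bigD1 k) //=.
by rewrite /Dr (tm_xx tmD) add0r.
Qed.

(** For [j] other than [k], the parent of [j] is one step closer to [k] and all its other neighbours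
    are one step further away. *)
Lemma laplacian_dist j k :
  \sum_l (e j l)%:R * (Dr j k - Dr l k) = (2 - d j) - 2 * (j == k)%:R.
Proof.
rewrite (eq_bigr (fun l => 2 * (if e j l && (D l k < D j k)%N then 1 else 0) - (e j l)%:R)).
  rewrite sumrB -mulr_sumr -big_mkcond /= (sum_closer k j (fun _ => 1)) -deg_sum.
  by rewrite -/d mulr1; case: (j == k) => /=; ring.
move=> l _; case jl: (e j l); rewrite ?mul0r ?mulr0 ?subrr //= mul1r /Dr.
case: (tm_edge tmD k jl) => ->; rewrite ?ltnSn ?ltnNge ?leqnSn /= -natr1; ring.
Qed.

Variables u v : 'I_n.
Let p x : R := (pos D u v x)%:R.
Let h x : R := (height D u v x)%:R.
Let c : R := (D u v).+1%:R.

Lemma dist_source x : Dr x u = p x + h x.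
Proof. by have [E _ _] := pos_heightP tmD u v x; rewrite /Dr E natrD. Qed.

Lemma dist_target x : Dr x v = c - 1 - p x + h x.
Proof.
have [_ _ /(congr1 (fun k => k%:R : R))] := pos_heightP tmD u v x.
by rewrite !natrD /Dr /p /h /c -natr1 => E; rewrite addrK; lra.
Qed.

(** Up to a constant, the position is half the difference of the distances to [u] and to [v], whose
    Laplacians differ only at these two vertices. *)
Lemma laplacian_pos j :
  \sum_l (e j l)%:R * (p j - p l) = (j == v)%:R - (j == u)%:R.
Proof.
rewrite (eq_bigr (fun l => 2^-1 * ((e j l)%:R * (Dr j u - Dr l u)) -
                           2^-1 * ((e j l)%:R * (Dr j v - Dr l v)))).
  by rewrite sumrB -!mulr_sumr !laplacian_dist; field.
by move=> l _; rewrite !dist_source !dist_target; field.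
Qed.

Lemma sum_geodesic (F : nat -> R) :
  \sum_(x | height D u v x == 0%N) F (pos D u v x) = \sum_(i < (D u v).+1) F i.
Proof.
have surj (i : 'I_(D u v).+1) : {x | height D u v x = 0%N /\ pos D u v x = i}.
  by apply: cid; have [|x] := pos_surj tmD (u := u) (v := v) (i := i); [rewrite -ltnS|exists x].
pose s i := sval (surj i); have sP i := svalP (surj i).
rewrite (reindex_onto s (fun x => inord (pos D u v x))) /=.
  apply: eq_big => [i|i _]; last by rewrite (sP i).2.
  by rewrite (sP i).1 (sP i).2 inord_val !eqxx.
move=> x /eqP hx; have [_ px _] := pos_heightP tmD u v x.
by apply: (pos_inj tmD (u := u) (v := v)); rewrite ?(sP _).1 ?(sP _).2 ?inordK ?ltnS.
Qed.

(** In [tree_edge_sum] rooted at [u], an edge off the path counts its position twice and a path edge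
    counts [g i + g i.-1]; the defect telescopes to g(0) - g(D u v), which the two extra degrees
    make up for. *)
Lemma sum_deg_pos (g : nat -> R) :
  \sum_x (d x + (x == u)%:R + (x == v)%:R) * g (pos D u v x) =
  2 * \sum_x g (pos D u v x).
Proof.
under eq_bigr => x _ do rewrite !mulrDl.
rewrite !big_split /= !sum_delta (tree_edge_sum u (fun x => g (pos D u v x))).
rewrite (eq_bigr (fun x => 2 * g (pos D u v x) + (if height D u v x == 0%N then
   g (pos D u v x).-1 - g (pos D u v x) else 0))); last first.
  move=> x xu; have := pos_parent tmD v xu; case: ifP => _.
    by move=> /andP[_ /eqP ->] /=; ring.
  by move=> /eqP ->; ring.
rewrite big_split -mulr_sumr /= -big_mkcondr /=.
(* Since [0.-1 = 0], the term of [u] vanishes and may be included in the sum. *)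
have := sum_geodesic (fun i => g i.-1 - g i).
have hu : height D u v u = 0%N.
  by have [+ _ _] := pos_heightP tmD u v u; rewrite (tm_xx tmD); lia.
rewrite (bigD1 u) ?hu //= (eq_bigl _ _ (fun x => andbC _ _)) (pos_source tmD) /= subrr add0r => ->.
rewrite [\sum_x g _](bigD1 u) //= (pos_source tmD) (pos_target tmD).
have -> : \sum_(i < (D u v).+1) (g i.-1 - g i) = g 0%N - g (D u v).
  elim: (D u v) => [|m IH]; first by rewrite big_ord_recl big_ord0 /= !subrr addr0.
  by rewrite big_ord_recr /= IH; ring.
ring.
Qed.
End TreeLaplacian.

(** * Closing a cycle *)

Section AddEdge.
Variables (R : realType) (n : nat) (e : rel 'I_n) (D : 'I_n -> 'I_n -> nat).
Hypothesis tmD : tree_metric e D.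
Variables u v : 'I_n.
Hypothesis uv : u != v.
Hypothesis nuv : ~~ e u v.
Let d := deg R e.
Let Dr x y : R := (D x y)%:R.
Let p x : R := (pos D u v x)%:R.
Let h x : R := (height D u v x)%:R.
Let c : R := (D u v).+1%:R.
Let G := add_edge e u v.
Let d' x := d x + (x == u)%:R + (x == v)%:R.
Let S := \sum_x \sum_y Dr x y.
Let H := \sum_x h x.
Let P1 := \sum_x \sum_y `|p x - p y|.
Let P2 := \sum_x \sum_y (p x - p y) ^+ 2.
(* If the tree path between two vertices shares [l] edges with the cycle, these
   contribute [l (c - l) / c = l - l^2 / c] to the resistance. *)
Let rho x y := Dr x y - (p x - p y) ^+ 2 / c.

Lemma add_edgeE x y : (G x y)%:R =
  (e x y)%:R + (x == u)%:R * (y == v)%:R + (x == v)%:R * (y == u)%:R :> R.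
Proof.
have F1 : ~~ ((x == u) && (x == v)).
  by apply: contraNN uv => /andP[/eqP <- /eqP <-].
have F2 : ~~ [&& e x y, x == u & y == v].
  by apply: contraNN nuv => /and3P[xy /eqP <- /eqP <-].
have F3 : ~~ [&& e x y, x == v & y == u].
  by apply: contraNN nuv => /and3P[xy /eqP <- /eqP <-]; rewrite (tm_adj_sym tmD).
rewrite /G /add_edge; move: F1 F2 F3.
by case: (e x y); case: (x == u); case: (y == v); case: (x == v); case: (y == u) => //= _ _ _;
  rewrite ?mul0r ?mulr0 ?mul1r ?addr0 ?add0r.
Qed.

Lemma deg_add_edge x : deg R G x = d' x.
Proof.
rewrite deg_sum; under eq_bigr => y _ do rewrite add_edgeE.
rewrite !big_split /= -!mulr_sumr -deg_sum /d' -/d.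
have one w : \sum_(y < n) (y == w)%:R = 1 :> R.
  rewrite -[RHS](sum_delta w (fun _ => 1)).
  by apply: eq_bigr => y _; rewrite mulr1.
by rewrite !one !mulr1.
Qed.

Lemma tree_deg_gt0 x : 0 < d x.
Proof.
have [k xk] : exists k, x != k.
  by have [->|xu] := eqVneq x u; [exists v|exists u].
have [z xz _] := tm_step tmD xk.
by rewrite /d /deg ltr0n; apply/card_gt0P; exists z.
Qed.

Lemma add_edge_deg_gt0 x : 0 < d' x.
Proof. by rewrite /d' -addrA ltr_wpDr ?addr_ge0 ?ler0n // tree_deg_gt0. Qed.

Lemma laplacian_add_edge (f : 'I_n -> R) j :
  \sum_l (G j l)%:R * (f j - f l) = \sum_l (e j l)%:R * (f j - f l) +
  ((j == u)%:R - (j == v)%:R) * (f u - f v).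
Proof.
under eq_bigr => l _ do rewrite add_edgeE !mulrDl -!mulrA.
rewrite !big_split /= -!mulr_sumr !(sum_delta _ (fun l => f j - f l)) -addrA.
congr (_ + _).
have [->|ju] := eqVneq j u; first by rewrite (negPf uv) /=; ring.
by have [->|jv] := eqVneq j v; rewrite /=; ring.
Qed.

Lemma c_neq0 : c != 0. Proof. by rewrite pnatr_eq0. Qed.

(** Terms linear in p_k cancel: the new edge contributes 2 p_k ([j = u] - [j = v]) through the
    distances, and the cross term of the square contributes the opposite, as the Laplacian of [p] in
    [G] is c ([j = v] - [j = u]). *)
Lemma laplacian_rho_add_edge : exists tau, forall j k,
  \sum_l (G j l)%:R * (rho j k - rho l k) = tau j - 2 * (j == k)%:R.
Proof.
have c0 := c_neq0.
pose sq j := \sum_l (G j l)%:R * (p j ^+ 2 - p l ^+ 2).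
exists (fun j => 2 - d j - (c - 1) * ((j == u)%:R - (j == v)%:R) - sq j / c) => j k.
have -> : \sum_l (G j l)%:R * (rho j k - rho l k) =
    \sum_l (G j l)%:R * (Dr j k - Dr l k) - sq j / c +
    2 * p k / c * \sum_l (G j l)%:R * (p j - p l).
  rewrite /sq mulr_suml mulr_sumr -sumrB -big_split; apply: eq_bigr => l _.
  by rewrite /rho /=; field; rewrite nat1r pnatr_eq0.
rewrite !laplacian_add_edge (laplacian_dist R tmD) (laplacian_pos R tmD).
have -> : Dr u k - Dr v k = 2 * p k - (c - 1).
  rewrite /Dr (tm_sym tmD u) (tm_sym tmD v).
  by rewrite /Dr (dist_source R tmD u v) (dist_target R tmD u v) -/(p _) -/(h _) -/c; ring.
have -> : p u - p v = 1 - c.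
  by rewrite /p (pos_source tmD) (pos_target tmD) /c -natr1; ring.
by rewrite -/d; field; rewrite nat1r pnatr_eq0.
Qed.

Let n_gt0 : (0 < n)%N. Proof. by case: (n) u => // -[]. Qed.

(** The left factor is twice the volume. Applying [sum_tree_deg_dist] once for each degree weight
    reduces the resistance sum to [S]. *)
Lemma kemeny_tree : kemeny R e * (2 * (2 * (n%:R - 1))) =
  4 * S - 2 * n%:R * (n%:R - 1) - 2 * (n%:R - 1) ^+ 2.
Proof.
have deg0 j : deg R e j != 0 by rewrite gt_eqF // tree_deg_gt0.
have Ddiag k : Dr k k = 0 by rewrite /Dr (tm_xx tmD).
rewrite (kemeny_resistance (tm_adj_sym tmD) deg0 Ddiag (laplacian_dist R tmD) n_gt0).
rewrite (sum_tree_deg R tmD u).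
rewrite mulfVK; last first.
  have := sum_tree_deg R tmD u => <-; rewrite mulf_neq0 ?pnatr_eq0 //.
  rewrite gt_eqF // (bigD1 u) //= ltr_wpDr ?tree_deg_gt0 //.
  by apply: sumr_ge0 => x _; apply/ltW/tree_deg_gt0.
rewrite exchange_big /= -/d.
under eq_bigr => k _ do (under eq_bigr => j _ do rewrite [d j * _]mulrC -mulrA).
under eq_bigr => k _ do rewrite -mulr_sumr (sum_tree_deg_dist R tmD k) mulrBr.
rewrite sumrB -mulr_suml (sum_tree_deg R tmD u).
have -> : \sum_k d k * (2 * \sum_x Dr x k) =
    2 * \sum_x (2 * (\sum_k Dr k x) - (n%:R - 1)).
  under eq_bigr => k _ do rewrite mulrCA mulr_sumr.
  rewrite -mulr_sumr exchange_big /=; congr (_ * _); apply: eq_bigr => x _.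
  by rewrite -(sum_tree_deg_dist R tmD x); apply: eq_bigr => k _; rewrite /Dr (tm_sym tmD).
rewrite sumrB sumr_const card_ord -mulr_sumr /S exchange_big /= -mulr_natr.
by ring.
Qed.

Lemma sum_add_edge_deg_dist k :
  \sum_j d' j * Dr j k = 2 * (\sum_j Dr j k) - n%:R + c + 2 * h k.
Proof.
under eq_bigr => j _ do rewrite /d' !mulrDl.
rewrite !big_split /= !sum_delta (sum_tree_deg_dist R tmD k).
rewrite /Dr (tm_sym tmD u) (tm_sym tmD v).
by rewrite (dist_source R tmD u v) (dist_target R tmD u v) -/(p _) -/(h _) -/c; ring.
Qed.

Lemma sum_add_edge_deg : \sum_j d' j = 2 * n%:R.
Proof.
have := sum_deg_pos tmD u v (fun _ => 1 : R).
under eq_bigr => x _ do rewrite mulr1.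
by rewrite sumr_const card_ord.
Qed.

(** Obtained by adding [sum_add_edge_deg_dist] for [u] and [v], as D_ju + D_jv = c - 1 + 2 h_j and
    [h] vanishes at both ends. *)
Lemma sum_add_edge_deg_height : \sum_j d' j * h j = 2 * H - n%:R + c.
Proof.
have := sum_add_edge_deg_dist u; have := sum_add_edge_deg_dist v.
have hE j : Dr j u + Dr j v = c - 1 + 2 * h j.
  by rewrite /Dr (dist_source R tmD u v) (dist_target R tmD u v) -/(p _) -/(h _) -/c; ring.
have h0 : h u = 0 /\ h v = 0.
  have [+ _ _] := pos_heightP tmD u v u; have [_ _] := pos_heightP tmD u v v.
  rewrite (pos_target tmD) !(tm_xx tmD) => hv hu; rewrite /h.
  by split; rewrite (_ : height _ _ _ _ = 0%N) //; lia.
rewrite h0.1 h0.2 => Ev Eu.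
have sum1 : \sum_j d' j * Dr j u + \sum_j d' j * Dr j v =
    (c - 1) * (2 * n%:R) + 2 * \sum_j d' j * h j.
  rewrite -big_split -sum_add_edge_deg !mulr_sumr -big_split; apply: eq_bigr => j _.
  by rewrite /= -mulrDr hE; ring.
have sum2 : \sum_j Dr j u + \sum_j Dr j v = (c - 1) * n%:R + 2 * H.
  rewrite -big_split /= (eq_bigr _ (fun j _ => hE j)) big_split /= sumr_const card_ord.
  by rewrite -mulr_sumr -/H; ring.
move: sum1; rewrite Eu Ev => sum1; lra.
Qed.

(** The squares depend on positions alone, so [sum_deg_pos] replaces each degree weight by 2; for
    the distances [sum_add_edge_deg_dist] removes the weights at the price of terms in [h]. *)
Lemma kemeny_add_edge : kemeny R G * (2 * (2 * n%:R)) =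
  4 * S + 8 * H + 4 * n%:R * (c - n%:R) + 2 * (c - n%:R) - 4 * P2 / c.
Proof.
have [tau tauE] := laplacian_rho_add_edge.
have Gsym : symmetric G.
  move=> x y; rewrite /G /add_edge /= (tm_adj_sym tmD x); congr (_ || _).
  by rewrite orbC; congr (_ || _); rewrite andbC.
have deg0 j : deg R G j != 0 by rewrite deg_add_edge gt_eqF // add_edge_deg_gt0.
have rdiag k : rho k k = 0.
  by rewrite /rho /Dr (tm_xx tmD) subrr expr0n mul0r subr0.
rewrite (kemeny_resistance Gsym deg0 rdiag tauE n_gt0).
under [X in _ / (2 * X)]eq_bigr => j _ do rewrite deg_add_edge.
rewrite sum_add_edge_deg.
rewrite mulfVK ?mulf_neq0 ?pnatr_eq0 -?lt0n //.
under eq_bigr => j _ do (under eq_bigr => k _ do rewrite !deg_add_edge /rho mulrBr).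
under eq_bigr => j _ do rewrite sumrB.
rewrite sumrB.
have -> : \sum_j \sum_k d' j * d' k * ((p j - p k) ^+ 2 / c) = 4 * P2 / c.
  under eq_bigr => j _ do (under eq_bigr => k _ do rewrite mulrA -[d' j * d' k]mulrC -!mulrA).
  rewrite exchange_big /=; under eq_bigr => k _ do rewrite -mulr_sumr.
  rewrite (eq_bigr (fun k => d' k * (2 * \sum_j (p j - p k) ^+ 2 / c))); last first.
    move=> k _; congr (_ * _).
    have := sum_deg_pos tmD u v (fun i => (i%:R - p k) ^+ 2 / c).
    by rewrite -/d => <-; apply: eq_bigr => i _; rewrite expr2 -!mulrA.
  apply: etrans (sum_deg_pos tmD u v (fun i => 2 * \sum_j (p j - i%:R) ^+ 2 / c)) _.
  under eq_bigr => k _ do rewrite -mulr_suml.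
  rewrite -mulr_sumr -mulr_suml /P2 [X in _ = 4 * X / c]exchange_big /= /p.
  move: (\sum_(i < n) _) => Z.
  by ring.
congr (_ - _).
rewrite exchange_big /=.
under eq_bigr => k _ do (under eq_bigr => j _ do rewrite [d' j * _]mulrC -mulrA).
under eq_bigr => k _ do rewrite -mulr_sumr sum_add_edge_deg_dist.
rewrite (eq_bigr (fun k => 2 * (\sum_j d' k * Dr k j) + (c - n%:R) * d' k +
    2 * (d' k * h k))); last first.
  move=> k _; rewrite -mulr_sumr.
  under [X in _ = 2 * (_ * X) + _ + _]eq_bigr => j _ do rewrite /Dr (tm_sym tmD).
  by rewrite -/(Dr _ _); ring.
rewrite !big_split /= -!mulr_sumr sum_add_edge_deg sum_add_edge_deg_height.
rewrite exchange_big /=.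
under eq_bigr => k _ do rewrite sum_add_edge_deg_dist.
rewrite !big_split /= sumrN !sumr_const card_ord -!mulr_sumr /S exchange_big /=.
rewrite -/H -[n%:R *+ n]mulr_natr -[c *+ n]mulr_natr.
move: (\sum_(j < n) _) (c) (H) (n%:R : R) => s a b m; ring.
Qed.

(** The diagonal is left out because the summand there would be 2 h_x. *)
Definition metric_excess : R :=
  \sum_x \sum_(y | y != x) (h x + h y + `|p x - p y| - Dr x y).

Lemma metric_excess_ge0 : 0 <= metric_excess.
Proof.
apply: sumr_ge0 => x _; apply: sumr_ge0 => y _.
have := tm_le_height tmD u v x y; rewrite -(ler_nat R) !natrD -/(p _) -/(h _).
rewrite natr_min -/(p _) -/(p _) -/(h _) -/(h _) -/(Dr x y).
by rewrite subr_ge0; case: (lerP (p x) (p y)) => pxy; lra.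
Qed.

(** Once the two formulas are combined, [S] and [H] occur only as -2 S + 4 (n - 1) H, which is twice
    [metric_excess] minus 2 P1. *)
Lemma kemeny_diff :
  2 * n%:R * (n%:R - 1) * (kemeny R G - kemeny R e) =
  2 * metric_excess + (n%:R - 1) * (c * (2 * n%:R + 1) - 2 * n%:R)
  - 2 * (P1 + (n%:R - 1) * P2 / c).
Proof.
have -> : metric_excess = 2 * (n%:R - 1) * H + P1 - S.
  have full x : \sum_(y | y != x) (h x + h y + `|p x - p y| - Dr x y) =
      \sum_y (h x + h y + `|p x - p y| - Dr x y) - 2 * h x.
    rewrite [in RHS](bigD1 x) //= subrr normr0 /Dr (tm_xx tmD); ring.
  rewrite /metric_excess (eq_bigr _ (fun x _ => full x)) sumrB -mulr_sumr -/H.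
  under eq_bigr => x _ do rewrite sumrB !big_split /= sumr_const card_ord -/H.
  rewrite sumrB !big_split /= sumr_const card_ord -/P1 -/S sumrMnl -/H -[H *+ n]mulr_natl.
  by move: H P1 S => a b s; ring.
have -> : 2 * n%:R * (n%:R - 1) * (kemeny R G - kemeny R e) =
  (n%:R - 1) / 2 * (kemeny R G * (2 * (2 * n%:R))) -
  n%:R / 2 * (kemeny R e * (2 * (2 * (n%:R - 1)))) by field.
rewrite kemeny_tree kemeny_add_edge.
have := c_neq0; move: (c) H P1 P2 S (n%:R : R) => a b p1 p2 s m a0.
by field.
Qed.
End AddEdge.

(** * Extremal positions *)

Section Spread.
Variables (R : realType) (kappa : R).
Hypothesis kappa_ge0 : 0 <= kappa.

(** With [kappa] equal to n - 1 over the cycle length, the double sum over the vertices is the last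
    bracket of [kemeny_diff]. *)
Definition spread (i j : nat) : R := `|i%:R - j%:R| + kappa * (i%:R - j%:R) ^+ 2.

Lemma spreadC i j : spread i j = spread j i.
Proof. by rewrite /spread distrC -[(_ - _) ^+ 2]sqrrN opprB. Qed.

Lemma spread0 j : spread 0 j = j%:R + kappa * j%:R ^+ 2.
Proof. by rewrite /spread sub0r normrN sqrrN ger0_norm. Qed.

Lemma sum_spread0 c :
  \sum_(j < c) spread 0 j =
  c%:R * (c%:R - 1) / 2 + kappa * (c%:R * (c%:R - 1) * (2 * c%:R - 1) / 6).
Proof.
elim: c => [|c IH]; first by rewrite big_ord0; field.
by rewrite big_ord_recr /= IH spread0 -natr1; field.
Qed.

Lemma sum_spread_last c : \sum_(j < c.+1) spread c j = \sum_(j < c.+1) spread 0 j.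
Proof.
rewrite (reindex_inj rev_ord_inj); apply: eq_bigr => j _.
have jc : (j <= c)%N by rewrite -ltnS.
by rewrite spread0 /spread /= subSS natrB // subKr ger0_norm.
Qed.

Lemma sum2_spread c :
  \sum_(i < c) \sum_(j < c) spread i j =
  c%:R * (c%:R ^+ 2 - 1) / 3 + kappa * (c%:R ^+ 2 * (c%:R ^+ 2 - 1) / 6).
Proof.
elim: c => [|c IH]; first by rewrite big_ord0; field.
rewrite big_ord_recr /= sum_spread_last sum_spread0.
under eq_bigr => i _ do rewrite big_ord_recr /= spreadC.
rewrite big_split /= IH.
have := sum_spread_last c; rewrite big_ord_recr /= sum_spread0 => /eqP.
rewrite /spread subrr normr0 expr0n mulr0 !addr0 => /eqP.
by rewrite -/(spread _ _) => ->; rewrite -!natr1; field.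
Qed.

(* Pairing [j] with [c - 1 - j] compares the two sides termwise. *)
Lemma sum_spread_le c i : (i < c)%N ->
  \sum_(j < c) spread i j <= \sum_(j < c) spread 0 j.
Proof.
move=> ic.
suff : \sum_(j < c) (spread i j + spread i (rev_ord j)) <=
       \sum_(j < c) (spread 0 j + spread 0 (rev_ord j)).
  have rev k : \sum_(j < c) spread k (c - j.+1)%N = \sum_(j < c) spread k j.
    by rewrite [RHS](reindex_inj rev_ord_inj).
  by rewrite big_split [leRHS]big_split /= !rev; lra.
apply: ler_sum => j _; rewrite !spread0 /spread /=.
have rE : (c - j.+1)%N%:R = c%:R - 1 - j%:R :> R.
  by rewrite natrB // -natr1 opprD addrA addrAC.
have jc : j%:R <= c%:R - 1 :> R by have := ler0n R (c - j.+1); rewrite rE; lra.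
have i0 : 0 <= i%:R :> R by [].
have j0 : 0 <= j%:R :> R by [].
have ic' : i%:R <= c%:R - 1 :> R by rewrite lerBrDr natr1 ler_nat.
rewrite rE; move: (i%:R) (j%:R) (c%:R) jc i0 j0 ic' => x y z jc i0 j0 ic' {rE}.
have K : 0 <= kappa * (x * (z - 1 - x)) by rewrite !mulr_ge0 // subr_ge0.
have N : `|x - y| + `|x - (z - 1 - y)| <= z - 1.
  by case: (lerP y x) => ?; case: (lerP (z - 1 - y) x) => ?; lra.
nra.
Qed.

(** The convex function of |i - j| is replaced by its chord on [0, c], which is exact for positions
    that coincide or are the two ends. *)
Lemma spread_le c i j : (i <= c)%N -> (j <= c)%N ->
  spread i j <= (1 + kappa * c%:R) * `|i%:R - j%:R|.
Proof.
move=> ic jc; rewrite /spread -real_normK ?num_real // mulrDl mul1r lerD2l -mulrA.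
rewrite ler_wpM2l // expr2 ler_wpM2r //.
by rewrite ler_norml -[i%:R]addr0; apply/andP; split;
  have := ler_nat R i c; have := ler_nat R j c; rewrite ic jc;
  have := ler0n R i; have := ler0n R j; lra.
Qed.

(** A threshold [t] contributes 1 exactly when it separates [i] from [j], and there are |i - j| of
    those. *)
Lemma dist_cuts c i j : (i <= c)%N -> (j <= c)%N ->
  `|i%:R - j%:R| = \sum_(t < c) ((i <= t)%N%:R * (1 - (j <= t)%N%:R) +
                               (j <= t)%N%:R * (1 - (i <= t)%N%:R)) :> R.
Proof.
wlog ij : i j / (i <= j)%N => [H ic jc|ic jc].
  have [ij|/ltnW ji] := leqP i j; first exact: H.
  by rewrite distrC H //; apply: eq_bigr => t _; rewrite addrC.
have -> : `|i%:R - j%:R| = (j - i)%N%:R :> R.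
  by rewrite distrC -natrB // ger0_norm.
have cut m : (j - i = \sum_(t < m) ((i <= t) && (t < j)) + (j - maxn i m))%N.
  elim: m => [|m IH]; first by rewrite big_ord0 maxn0.
  rewrite big_ord_recr /= {1}IH -!addnA; congr (_ + _)%N.
  by case: (leqP i m) => ?; case: (ltnP m j) => ? /=; lia.
rewrite (cut c) natrD natr_sum (_ : (j - maxn i c)%N = 0%N) ?addr0; last by lia.
apply: eq_bigr => t _.
by case: (leqP i t) => it; case: (leqP j t) => jt //=;
  rewrite ?mulr0 ?mul0r ?subrr ?subr0 ?mulr0 ?mulr1 ?addr0 ?add0r //; lia.
Qed.

Variables (n c : nat) (p : 'I_n -> nat) (Q : pred 'I_n).
Hypothesis p_le : forall x, (p x <= c)%N.
Hypothesis sumQ : forall F : nat -> R, \sum_(x | Q x) F (p x) = \sum_(i < c.+1) F i.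

(** [Q] stands for the path, which takes every position once. Its own pairs contribute a fixed
    amount, so only the vertices off it matter. *)
Lemma spread_split :
  \sum_x \sum_y spread (p x) (p y) =
  \sum_(i < c.+1) \sum_(j < c.+1) spread i j
  + 2 * \sum_(y | ~~ Q y) \sum_(i < c.+1) spread (p y) i
  + \sum_(y | ~~ Q y) \sum_(z | ~~ Q z) spread (p y) (p z).
Proof.
have := spreadC; move: spread => s sC.
have splitQ (F : nat -> R) :
    \sum_x F (p x) = \sum_(i < c.+1) F i + \sum_(y | ~~ Q y) F (p y).
  by rewrite (bigID Q) /= sumQ.
rewrite (splitQ (fun i => \sum_y s i (p y))).
under eq_bigr => i _ do rewrite splitQ.
under [X in _ + X]eq_bigr => i _ do rewrite splitQ.
rewrite !big_split /= [\sum_(i < c.+1) \sum_(y | ~~ Q y) _]exchange_big /=.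
rewrite -[RHS]addrA mulrDl mul1r -!addrA; congr (_ + (_ + _)).
by apply: eq_bigr => y _; apply: eq_bigr => i _; rewrite sC.
Qed.

Let N := (n - c.+1)%N.

Lemma card_notQ : \sum_(y | ~~ Q y) 1 = N%:R :> R.
Proof.
have : \sum_(x < n) (1 : R) = n%:R by rewrite sumr_const card_ord.
rewrite (bigID Q) /= (sumQ (fun _ => 1)) sumr_const card_ord => nE.
have cn : (c.+1 <= n)%N.
  rewrite -(ler_nat R) -nE lerDl; apply: sumr_ge0 => //.
by rewrite /N natrB // -nE addrAC subrr add0r.
Qed.

(** With l = N - k, N^2 - 4 k l = (l - k)^2, which is at least 1 when N is odd. *)
Lemma balanced_prod k : (k <= N)%N ->
  (k%:R * (N%:R - k%:R) : R) <= (N%:R ^+ 2 - (odd N)%:R) / 4.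
Proof.
move=> kN; have : (4 * (k * (N - k)) + odd N <= N * N)%N.
  have [l ->] : exists l, N = (k + l)%N by exists (N - k)%N; rewrite subnKC.
  rewrite addKn; wlog kl : k l {kN} / (k <= l)%N => [H|].
    by have [|/ltnW] := leqP k l => /H; rewrite // [(l + k)%N]addnC [(l * k)%N]mulnC.
  rewrite -(subnKC kl); move: (l - k)%N => d.
  have : (odd d <= d * d)%N by case: d => // d; case: (odd _).
  by rewrite addnA oddD addnn odd_double /= -addnn; nia.
rewrite -(ler_nat R) natrD !natrM natrB //; lra.
Qed.

(** Each of the [c] thresholds splits the [N] vertices off the path into [A t] and [N - A t], hence
    separates 2 A_t (N - A_t) ordered pairs. *)
Lemma sum_notQ_dist :
  \sum_(y | ~~ Q y) \sum_(z | ~~ Q z) `|(p y)%:R - (p z)%:R| <=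
  c%:R * (2 * ((N%:R ^+ 2 - (odd N)%:R) / 4)) :> R.
Proof.
pose A t : R := \sum_(y | ~~ Q y) (p y <= t)%N%:R.
have -> : \sum_(y | ~~ Q y) \sum_(z | ~~ Q z) `|(p y)%:R - (p z)%:R| =
    \sum_(t < c) 2 * (A t * (N%:R - A t)) :> R.
  transitivity (\sum_(y | ~~ Q y) \sum_(z | ~~ Q z) \sum_(t < c)
     ((p y <= t)%N%:R * (1 - (p z <= t)%N%:R) + (p z <= t)%N%:R * (1 - (p y <= t)%N%:R)) : R).
    by apply: eq_bigr => y _; apply: eq_bigr => z _; apply: dist_cuts.
  under eq_bigr => y _ do rewrite exchange_big /=.
  rewrite exchange_big /=; apply: eq_bigr => t _.
  under eq_bigr => y _ do rewrite big_split /= -mulr_sumr -mulr_suml sumrB card_notQ -/(A t).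
  by rewrite big_split /= -mulr_suml -mulr_sumr sumrB card_notQ -/(A t); ring.
rewrite -[X in X%:R * _]card_ord mulr_natl -sumr_const.
apply: ler_sum => t _; rewrite ler_wpM2l //.
have -> : A t = #|[pred y | ~~ Q y & (p y <= t)%N]|%:R.
  rewrite /A -sum1_card natr_sum big_mkcondr /=.
  by apply: eq_bigr => y _; case: leqP.
apply: balanced_prod; rewrite -(ler_nat R) -card_notQ -sum1_card natr_sum.
rewrite [leLHS]big_mkcondr /=; apply: ler_sum => y _.
by case: ifP.
Qed.

(* [(N^2 - odd N) / 4] is the product of the two halves of [N]. *)
Definition max_spread : R :=
  \sum_(i < c.+1) \sum_(j < c.+1) spread i j
  + 2 * (N%:R * \sum_(i < c.+1) spread 0 i)
  + 2 * ((N%:R ^+ 2 - (odd N)%:R) / 4) * spread 0 c.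

(** The parts of [spread_split] are bounded separately: [sum_spread_le] moves every vertex off the
    path to an end, and the chord bound with [sum_notQ_dist] balances the two ends. *)
Lemma spread_le_max : \sum_x \sum_y spread (p x) (p y) <= max_spread.
Proof.
rewrite spread_split /max_spread -!addrA lerD2l; apply: lerD.
  rewrite ler_wpM2l // -card_notQ mulr_suml; apply: ler_sum => y _.
  by rewrite mul1r sum_spread_le // ltnS.
apply: (@le_trans _ _ ((1 + kappa * c%:R) *
    \sum_(y | ~~ Q y) \sum_(z | ~~ Q z) `|(p y)%:R - (p z)%:R|)).
  rewrite mulr_sumr; apply: ler_sum => y _; rewrite mulr_sumr; apply: ler_sum => z _.
  exact: spread_le.
apply: le_trans (ler_wpM2l _ sum_notQ_dist) _; last by rewrite spread0; lra.
by rewrite addr_ge0 // mulr_ge0.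
Qed.

Lemma spread_eq_max (B : pred 'I_n) :
  (forall y, ~~ Q y -> p y = if B y then 0%N else c) ->
  #|[pred y | ~~ Q y & B y]| = N./2 ->
  \sum_x \sum_y spread (p x) (p y) = max_spread.
Proof.
move=> pE cardB; rewrite spread_split /max_spread; congr (_ + _ * _ + _).
  rewrite -card_notQ mulr_suml; apply: eq_bigr => y Qy; rewrite mul1r pE //.
  by case: (B y); rewrite ?sum_spread_last.
have sumB : \sum_(y | ~~ Q y) (B y)%:R = (N./2)%:R :> R.
  rewrite -cardB -sum1_card natr_sum big_mkcondr /=.
  by apply: eq_bigr => y _; case: (B y).
have cc k : spread k k = 0 by rewrite /spread subrr normr0 expr0n mulr0 addr0.
(* Two vertices off the path contribute only at opposite ends, that is when [B] separates them. *)
transitivity (\sum_(y | ~~ Q y) \sum_(z | ~~ Q z)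
   ((B y)%:R * (1 - (B z)%:R) + (B z)%:R * (1 - (B y)%:R)) * spread 0 c).
  apply: eq_bigr => y Qy; apply: eq_bigr => z Qz; rewrite !pE //.
  by case: (B y); case: (B z); rewrite ?cc ?[spread c 0]spreadC /=; ring.
under eq_bigr => y _ do rewrite -mulr_suml big_split /= -mulr_sumr -mulr_suml sumrB card_notQ sumB.
rewrite -mulr_suml big_split /= -mulr_suml -mulr_sumr sumrB card_notQ sumB.
congr (_ * _); rewrite -[in N%:R](odd_double_half N) natrD -muln2 natrM.
have : (odd N)%:R ^+ 2 = (odd N)%:R :> R by case: (odd N); rewrite ?expr1n ?expr0n.
move: (odd N)%:R (N./2)%:R => a b aa; rewrite expr2 in aa; lra.
Qed.
End Spread.

(** * The optimal cycle length *)

Section CycleLength.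
Variables (R : realType) (n : nat).
Hypothesis n_ge : (23 <= n)%N.
Let m : R := n%:R.

(* [6 n (n - 1)] times the least change when the cycle has length [c]. *)
Definition f_parity (c : nat) : R := if odd (n - c) then f_o n c%:R else f_e n c%:R.

(** Here [c] counts the edges of the path, so the cycle has length [c.+1]. The term [odd N] in
    [max_spread] is what separates [f_o] from [f_e]. *)
Lemma max_spreadE c : (c < n)%N ->
  3 * ((m - 1) * (c.+1%:R * (2 * m + 1) - 2 * m) -
       2 * max_spread ((m - 1) / c.+1%:R) n c) = f_parity c.+1.
Proof.
move=> cn; rewrite /max_spread sum2_spread sum_spread0 spread0 /f_parity /f_o /f_e -/m.
have NE : (n - c.+1)%N%:R = m - c.+1%:R by rewrite natrB.
rewrite NE; have -> : c%:R = c.+1%:R - 1 :> R by rewrite -natr1 addrK.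
have : c.+1%:R != 0 :> R by rewrite pnatr_eq0.
move: (c.+1%:R : R) (m) => k a k0.
by case: (odd _) => /=; field.
Qed.

Let m_ge : 23 <= m. Proof. by rewrite (ler_nat R 23). Qed.
Let A := 2 * m ^+ 2 - 2 * m - 3.
Let V := 3 * m / 4 + 21 / 64.
(** The common shape of [f_e] and [f_o], which differ only in [B], [C] and [E]; [V] is c^*. *)
Let profile (B C E c : R) := c ^+ 3 + A * c ^+ 2 + B * c + C - E / c.

Lemma profileB B C E c U : c != 0 -> U != 0 -> profile B C E U - profile B C E c =
  (U - c) * (c ^+ 2 + c * U + U ^+ 2 + A * (c + U) + B + E / (c * U)).
Proof. by move=> c0 U0; rewrite /profile; field; rewrite c0 U0. Qed.

(** The second factor of [profileB] has to be nonpositive. Apart from the quotient it is largest at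
    c = V - 2, U = V, where the cubic terms in m cancel and -5/2 m^2 dominates. *)
Lemma profile_left B C E c U : B <= - 3 * m ^+ 3 + 6 * m - 1 -> E <= 3 * m ^+ 3 ->
  3 <= c -> c <= U - 2 -> V - 2 <= U -> U <= V -> profile B C E U <= profile B C E c.
Proof.
move=> hB hE c3 cU VU UV; have U0 : 0 < U by lra.
have c0 : 0 < c by lra.
have mp := m_ge.
rewrite -subr_le0 profileB ?gt_eqF //; apply: mulr_ge0_le0; first lra.
have hEc : E / (c * U) <= 3 / 2 * m ^+ 2.
  rewrite ler_pdivrMr ?mulr_gt0 //; apply: le_trans hE _.
  (* From c >= 3, U >= V - 2 and m >= 23; this keeps the quotient quadratic in m. *)
  have cU3 : 2 * m <= c * U by rewrite /V in VU; nra.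
  have m2 : 0 <= m ^+ 2 by rewrite sqr_ge0.
  have := ler_wpM2l m2 cU3; rewrite exprS; lra.
have h1 : c ^+ 2 + c * U + U ^+ 2 <= 3 * V ^+ 2 - 6 * V + 4.
  have := ler_pM (ltW c0) (ltW c0) cU cU.
  have := ler_wpM2r (ltW U0) cU.
  nra.
have A0 : 0 <= A by rewrite /A; nra.
have h2 : A * (c + U) <= A * (2 * V - 2) by rewrite ler_wpM2l //; lra.
apply: (@le_trans _ _ (3 * V ^+ 2 - 6 * V + 4 + A * (2 * V - 2) +
  (- 3 * m ^+ 3 + 6 * m - 1) + 3 / 2 * m ^+ 2)); first by lra.
have -> : 3 * V ^+ 2 - 6 * V + 4 + A * (2 * V - 2) +
  (- 3 * m ^+ 3 + 6 * m - 1) + 3 / 2 * m ^+ 2 =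
  22059 / 4096 + 149 / 128 * m - 5 / 2 * m ^+ 2 by rewrite /A /V; field.
nra.
Qed.

(** Here the quotient is dropped, and the rest of the second factor is least at U = V, c = V + 2,
    where the cubic terms cancel again and 4 m^2 dominates. *)
Lemma profile_right B C E c U : - 3 * m ^+ 3 + 3 * m - 1 <= B -> 0 <= E ->
  U + 2 <= c -> V <= U -> profile B C E U <= profile B C E c.
Proof.
move=> hB hE Uc VU; have mp := m_ge.
have V0 : 0 < V by rewrite /V; lra.
have U0 : 0 < U by lra.
have c0 : 0 < c by lra.
rewrite -subr_le0 profileB ?gt_eqF //; apply: mulr_le0_ge0; first lra.
have hEc : 0 <= E / (c * U) by rewrite divr_ge0 // mulr_ge0 // ltW.
have h1 : 3 * V ^+ 2 + 6 * V + 4 <= c ^+ 2 + c * U + U ^+ 2.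
  have U1 : V ^+ 2 <= U ^+ 2 by rewrite !expr2 ler_pM // ltW.
  have := ler_wpM2r (ltW U0) Uc; have c1 : (U + 2) ^+ 2 <= c ^+ 2.
    by rewrite !expr2 ler_pM //; lra.
  rewrite sqrrD in c1; lra.
have A0 : 0 <= A by rewrite /A; nra.
have h2 : A * (2 * V + 2) <= A * (c + U) by rewrite ler_wpM2l //; lra.
apply: (@le_trans _ _ (3 * V ^+ 2 + 6 * V + 4 + A * (2 * V + 2) +
  (- 3 * m ^+ 3 + 3 * m - 1))); last by lra.
have -> : 3 * V ^+ 2 + 6 * V + 4 + A * (2 * V + 2) + (- 3 * m ^+ 3 + 3 * m - 1) =
  4 * m ^+ 2 - 107 / 128 * m - 10965 / 4096 by rewrite /A /V; field.
nra.
Qed.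

Lemma f_eE c : f_e n c = profile (- 3 * m ^+ 3 + 3 * m - 1)
  (6 * m ^+ 3 - 5 * m ^+ 2 + 2 * m) (3 * m ^+ 3 - 3 * m ^+ 2) c.
Proof.
by rewrite /f_e /profile -/m /A -[- (_ / _)]mulNr; congr (_ + _ / _); ring.
Qed.

Lemma f_oE c : f_o n c = profile (- 3 * m ^+ 3 + 6 * m - 1)
  (6 * m ^+ 3 - 5 * m ^+ 2 - 4 * m + 3) (3 * m ^+ 3 - 3 * m ^+ 2 - 3 * m + 3) c.
Proof.
by rewrite /f_o /profile -/m /A -[- (_ / _)]mulNr; congr (_ + _ / _); ring.
Qed.

Let E_bounds : [/\ 0 <= 3 * m ^+ 3 - 3 * m ^+ 2, 3 * m ^+ 3 - 3 * m ^+ 2 <= 3 * m ^+ 3,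
  0 <= 3 * m ^+ 3 - 3 * m ^+ 2 - 3 * m + 3 &
  3 * m ^+ 3 - 3 * m ^+ 2 - 3 * m + 3 <= 3 * m ^+ 3].
Proof.
have mp := m_ge; have m2 : 0 <= m ^+ 2 by rewrite sqr_ge0.
have m3 : 23 * m ^+ 2 <= m ^+ 3 by rewrite [m ^+ 3]exprS ler_wpM2r.
have m1 : 23 * m <= m ^+ 2 by rewrite expr2 ler_wpM2r //; lra.
by split; lra.
Qed.

Lemma f_parity_left c U : odd c = odd U -> (3 <= c)%N -> (c.+2 <= U)%N -> (U <= n)%N ->
  V - 2 <= U%:R -> U%:R <= V -> f_parity U <= f_parity c.
Proof.
move=> cU c3 c2 Un VU UV.
have c3' : 3 <= c%:R :> R by rewrite (ler_nat R 3).
have cU' : c%:R <= U%:R - 2 :> R by rewrite lerBrDr -natrD ler_nat addn2.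
have mp := m_ge; have [E1 E2 E3 E4] := E_bounds.
rewrite /f_parity !oddB ?(leq_trans _ Un) // 1?(leq_trans _ c2) // 1?ltnW // cU.
by case: ifP => _; rewrite ?f_oE ?f_eE; apply: profile_left => //; lra.
Qed.

Lemma f_parity_right c U : odd c = odd U -> (U.+2 <= c)%N -> (c <= n)%N ->
  V <= U%:R -> f_parity U <= f_parity c.
Proof.
move=> cU c2 cn VU.
have cU' : U%:R + 2 <= c%:R :> R by rewrite -natrD ler_nat addn2.
have mp := m_ge; have [E1 E2 E3 E4] := E_bounds.
have Un : (U <= n)%N by apply: leq_trans cn; apply: ltnW; apply: ltnW.
rewrite /f_parity !oddB // cU.
by case: ifP => _; rewrite ?f_oE ?f_eE; apply: profile_right => //; lra.
Qed.

Let L := ((48 * n + 21) %/ 64)%N.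

(** As c^* = (48 n + 21) / 64 has an odd numerator, it is not an integer: its floor is L and its
    ceiling L + 1. *)
Let L_bounds : L%:R < V < L%:R + 1.
Proof.
have l1 : (64 * L < 48 * n + 21)%N by rewrite /L; lia.
have l2 : (48 * n + 21 < 64 * L.+1)%N by rewrite /L; lia.
move: l1 l2; rewrite -!(ltr_nat R) !natrM natrD natrM -natr1 -/m /V => l1 l2.
by apply/andP; split; lra.
Qed.

(** For n = 8 q + r, L is 6 q plus the floor of (48 r + 21) / 64, so the parity of n - L depends on
    r alone. This is the origin of the residue classes. *)
Let L_parity : odd (n - L) = (n %% 8 \notin [:: 0; 1; 6; 7])%N.
Proof.
rewrite /L; have := divn_eq n 8; have := ltn_pmod n (isT : (0 < 8)%N).
move: (n %% 8)%N (n %/ 8)%N => r q r8 ->.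
rewrite !inE; case: r r8 => [|[|[|[|[|[|[|[|r]]]]]]]] // _ /=; lia.
Qed.

(** Both branches of the claim try the lengths L - 1, ..., L + 2, each with the function matching
    its parity, so they collapse into one expression. *)
Lemma claimed_minE : claimed_min R n = (6 * m * (m - 1))^-1 *
  min4 (f_parity L) (f_parity L.+2) (f_parity L.+1) (f_parity L.-1).
Proof.
have /andP[V1 V2] := L_bounds.
have flE : Num.floor (cstar R n) = L%:Z.
  by apply: floor_def; rewrite intrD /= -/m; apply/andP; split; [apply: ltW|].
have ceE : Num.ceil (cstar R n) = L%:Z + 1.
  by apply: ceil_def; rewrite addrK intrD /= -/m; apply/andP; split; [|apply: ltW].
have Ln : (L.+2 <= n)%N by rewrite /L; lia.
have L0 : (0 < L)%N by rewrite /L; lia.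
rewrite /claimed_min flE ceE -/m; congr (_ * _).
have z1 : (L%:Z + 1 : int)%:~R = L.+1%:R :> R by rewrite -natr1 intrD.
have z2 : (L%:Z + 2 : int)%:~R = L.+2%:R :> R by rewrite -[L.+2]addn2 natrD intrD.
have z3 : (L%:Z + 1 - 2 : int)%:~R = L.-1%:R :> R.
  by rewrite -[in RHS]subn1 natrB // !intrD /=; ring.
rewrite z1 z2 z3 /f_parity.
have -> : odd (n - L.+1) = ~~ odd (n - L) by lia.
have -> : odd (n - L.+2) = odd (n - L) by lia.
have -> : odd (n - L.-1) = ~~ odd (n - L) by lia.
by rewrite L_parity; case: (_ \in _).
Qed.

Lemma denom_gt0 : 0 < 6 * m * (m - 1).
Proof. by have mp := m_ge; rewrite !mulr_gt0 //; lra. Qed.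

(** A length below L - 1 is compared with whichever of L - 1 and L has its parity, a length above L
    + 2 with whichever of L + 1 and L + 2 has it. *)
Lemma claimed_min_le c : (3 <= c <= n)%N ->
  claimed_min R n <= f_parity c / (6 * m * (m - 1)).
Proof.
move=> /andP[c3 cn]; rewrite claimed_minE mulrC ler_pM2r ?invr_gt0 ?denom_gt0 //.
have /andP[V1 V2] := L_bounds.
have Ln : (L.+2 <= n)%N by rewrite /L; lia.
have L3 : (4 <= L)%N by rewrite /L; lia.
have L1E : L.-1%:R = L%:R - 1 :> R by rewrite -subn1 natrB //; lia.
rewrite /min4 !ge_min.
have [cL|Lc] := ltnP c L.-1.
  have [par|par] := boolP (odd c == odd L).
    by rewrite (f_parity_left (eqP par) c3) //; [lia|lia|lra|exact: ltW].
  rewrite (f_parity_left (U := L.-1) _ c3) ?orbT //; try lia.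
  - by rewrite L1E; lra.
  - by rewrite L1E; lra.
have [cL|Lc'] := ltnP L.+2 c.
  have [par|par] := boolP (odd c == odd L).
    rewrite (f_parity_right (U := L.+2)) ?orbT //; try lia.
    by rewrite -!natr1; lra.
  rewrite (f_parity_right (U := L.+1)) ?orbT //; try lia.
  by rewrite -natr1; lra.
have : c \in [:: L; L.+2; L.+1; L.-1] by rewrite !inE; lia.
by rewrite !inE => /or4P[] /eqP ->; rewrite lexx ?orbT.
Qed.

Lemma claimed_min_attained : exists2 c, (3 <= c <= n)%N &
  claimed_min R n = f_parity c / (6 * m * (m - 1)).
Proof.
have Ln : (L.+2 <= n)%N by rewrite /L; lia.
have L3 : (4 <= L)%N by rewrite /L; lia.
rewrite claimed_minE /min4 mulrC.
have [xy|xy] := leP (Num.min (f_parity L) (f_parity L.+2))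
  (Num.min (f_parity L.+1) (f_parity L.-1)).
  have [ab|ab] := leP (f_parity L) (f_parity L.+2).
    by exists L => //; lia.
  by exists L.+2 => //; lia.
have [ab|ab] := leP (f_parity L.+1) (f_parity L.-1).
  by exists L.+1 => //; lia.
by exists L.-1 => //; lia.
Qed.
End CycleLength.

(** * The distance of a tree *)

Section GraphDistance.
Variables (n : nat) (e : rel 'I_n).
Hypothesis e_tree : is_tree e.

Let irr x : e x x = false. Proof. by case: e_tree => -[/(_ x)/negPf]. Qed.
Let sym : symmetric e. Proof. by case: e_tree => -[]. Qed.

(** A path avoiding the edge would be closed by it into a cycle, of length at least 3 because [x]
    and [y] differ and a single step would be the edge itself. *)
Lemma tree_bridge x y : e x y ->
  ~~ connect [rel a b | e a b && ~~ ((a == x) && (b == y) || (a == y) && (b == x))] x y.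
Proof.
move=> xy; apply/negP => /connectP [p0 pth0 yE].
case/shortenP: pth0 yE => p pth Up _ yE.
have [_ [_ acyclic]] := e_tree; apply: acyclic.
exists (x :: p); split => //.
  case: p pth {Up} yE => [|a [|b p]] //= pth yE; first by rewrite yE irr in xy.
  by move: pth; rewrite -yE !eqxx andbT /= andbF.
rewrite /= rcons_path -yE sym xy andbT.
by apply: sub_path pth => a b /= /andP[].
Qed.

Let walk x y k := `[< exists p, [/\ path e x p, last x p = y & size p = k] >].

Lemma walk_ex x y : exists k, walk x y k.
Proof.
have [_ [conn _]] := e_tree; have /connectP [p pth yE] := conn x y.
by exists (size p); apply/asboolP; exists p.
Qed.

Definition graph_dist x y := ex_minn (walk_ex x y).

Lemma graph_dist_le x p : path e x p -> (graph_dist x (last x p) <= size p)%N.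
Proof.
move=> pth; rewrite /graph_dist; case: ex_minnP => k _; apply.
by apply/asboolP; exists p.
Qed.

Lemma graph_distP x y : exists p, [/\ path e x p, last x p = y & size p = graph_dist x y].
Proof. by rewrite /graph_dist; case: ex_minnP => k /asboolP. Qed.

Lemma graph_dist_sym x y : graph_dist x y = graph_dist y x.
Proof.
suff le a b : (graph_dist a b <= graph_dist b a)%N by apply/eqP; rewrite eqn_leq !le.
have [p [pth <- <-]] := graph_distP b a.
have := @graph_dist_le (last b p) (rev (belast b p)).
rewrite rev_path size_rev size_belast (eq_path (e' := e)) => [|u v]; last exact: sym.
move=> /(_ pth); case: p pth => [|c p] //= _.
by rewrite rev_cons last_rcons.
Qed.

Lemma graph_dist_step x y : x != y -> exists2 z, e x z & graph_dist x y = (graph_dist z y).+1.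
Proof.
move=> xy; have [[|z p] [pth pE sE]] := graph_distP x y.
  by rewrite /= in pE; rewrite pE eqxx in xy.
move: pth pE sE => /= /andP[xz pth] pE sE; exists z => //.
apply/eqP; rewrite eqn_leq -{2}sE ltnS; apply/andP; split; last first.
  by rewrite -pE graph_dist_le.
have [q [qth qE <-]] := graph_distP z y.
by have := @graph_dist_le x (z :: q); rewrite /= xz qE; apply.
Qed.

Lemma graph_dist_adj x y k : e x y -> (graph_dist x k <= (graph_dist y k).+1)%N.
Proof.
move=> xy; have [q [qth qE <-]] := graph_distP y k.
by have := @graph_dist_le x (y :: q); rewrite /= xy qE; apply.
Qed.

(** Descends along a geodesic to [k], which uses only edges that decrease the distance. *)
Lemma geodesic_connect (e' : rel 'I_n) k m :
  (forall a b, e a b -> (graph_dist b k < graph_dist a k <= m)%N -> e' a b) ->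
  forall z, (graph_dist z k <= m)%N -> connect e' z k.
Proof.
move=> e'P z; have [N] := ubnP (graph_dist z k).
elim: N z => // N IH z zN zm.
have [->|zk] := eqVneq z k; first exact: connect0.
have [w zw wE] := graph_dist_step zk.
have zw' : connect e' z w by apply/connect1/e'P => //; rewrite wE ltnSn -wE.
by apply: connect_trans zw' (IH _ _ _); lia.
Qed.

(** Both nontrivial axioms follow from [tree_bridge]. If the ends of an edge were equally far from
    [k], geodesics to [k] would join them without that edge; if [x] had two neighbours closer to
    [k], a route through one of them and [k] to the other would avoid the edge from [x] to the
    latter. *)
Lemma is_tree_metric : tree_metric e graph_dist.
Proof.
pose cut x y := [rel a b | e a b && ~~ ((a == x) && (b == y) || (a == y) && (b == x))].
have cut_sym x y : connect_sym (cut x y).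
  by apply: sym_connect_sym => a b /=; rewrite sym orbC [(a == y) && _]andbC [(a == x) && _]andbC.
split=> //.
- exact: graph_dist_sym.
- by move=> x; apply/eqP; rewrite -leqn0 (@graph_dist_le x [::]).
- move=> x y k xy; have := graph_dist_adj k xy.
  have := @graph_dist_adj y x k; rewrite sym => /(_ xy).
  have [E|] := eqVneq (graph_dist x k) (graph_dist y k); last by lia.
  case/negP: (tree_bridge xy).
  have con z : (graph_dist z k <= graph_dist x k)%N -> connect (cut x y) z k.
    apply: geodesic_connect => a b ab /andP[lt _]; rewrite /= ab /=.
    by apply: contraTN lt => /orP[] /andP[/eqP -> /eqP ->]; rewrite E ltnn.
  by apply: (connect_trans (con x _)); rewrite // cut_sym con // E.
- exact: graph_dist_step.
- move=> x k z z' xz xz' zk z'k; apply/eqP; apply: contraT => zz'.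
  case/negP: (tree_bridge xz).
  have con w : (graph_dist w k < graph_dist x k)%N -> connect (cut x z) w k.
    move=> wk; apply: (@geodesic_connect _ _ (graph_dist x k).-1); last by lia.
    move=> a b ab /andP[lt le]; rewrite /= ab /=.
    by apply/negP => /orP[] /andP[/eqP aE /eqP bE]; move: lt le; rewrite aE bE; lia.
  apply: (@connect_trans _ _ z').
    apply: connect1; rewrite /= xz' eqxx /= (eq_sym z') (negPf zz') /=.
    by apply/negP => /andP[_ /eqP z'x]; rewrite z'x irr in xz'.
  by apply: (connect_trans (con z' z'k)); rewrite cut_sym con.
Qed.
End GraphDistance.

(** * Double brooms *)

Section ParentTree.
Variables (n : nat) (par : 'I_n -> nat).
Hypothesis par_lt : forall x : 'I_n, (0 < x)%N -> (par x < x)%N.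

Definition parent_rel : rel 'I_n :=
  fun x y => ((0 < x)%N && (par x == y)) || ((0 < y)%N && (par y == x)).

Lemma parent_rel_sym : symmetric parent_rel.
Proof. by move=> x y; rewrite /parent_rel orbC. Qed.

Lemma parent_rel_lt (x y : 'I_n) : parent_rel x y -> (y <= x)%N -> par x = y.
Proof.
case/orP => /andP[y0 /eqP //]; move=> E yx.
by have := par_lt y0; rewrite E ltnNge yx.
Qed.

Lemma parent_rel_irr x : ~~ parent_rel x x.
Proof.
by rewrite /parent_rel orbb; apply/negP => /andP[/par_lt + /eqP E]; rewrite E ltnn.
Qed.

(** Following parents leads down to 0. The largest vertex of a cycle would have two distinct
    neighbours in it, both smaller and hence both its parent. *)
Lemma parent_rel_tree : is_tree parent_rel.
Proof.
split; first by split; [exact: parent_rel_irr|exact: parent_rel_sym].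
split.
  have csym : connect_sym parent_rel by apply: sym_connect_sym; exact: parent_rel_sym.
  suff to0 (x z : 'I_n) : val z = 0%N -> connect parent_rel x z.
    move=> x y; have n0 : (0 < n)%N by case: (n) x => // -[].
    apply: (@connect_trans _ _ (Ordinal n0)); first exact: to0.
    by rewrite csym; exact: to0.
  move=> z0; have [m] := ubnP x; elim: m x => // m IH x xm.
  have [x0|x0] := posnP x; first by rewrite (_ : x = z) //; apply: val_inj; rewrite z0.
  have lt := par_lt x0; have pn := ltn_trans lt (ltn_ord x).
  apply: (@connect_trans _ _ (Ordinal pn)).
    by apply: connect1; rewrite /parent_rel x0 /= eqxx.
  by apply: IH => /=; apply: leq_trans lt _.
case=> s [s2 Us cyc].
have [x0 x0s] : exists x, x \in s by case: s s2 {Us cyc} => // x s _; exists x; rewrite mem_head.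
case: (@arg_maxnP _ x0 (mem s) val x0s) => x xs xmax.
have {xs} [i s' rotE] := rot_to xs.
have := cyc; rewrite -(rot_cycle i) rotE.
have := Us; rewrite -(rot_uniq i) rotE.
have mem y : y \in x :: s' -> (y <= x)%N by rewrite -rotE mem_rot; exact: xmax.
have : (1 < size s')%N by have := size_rot i s; rewrite rotE /=; lia.
case: s' mem {rotE} => [|y [|z t]] // mem _ U /=.
rewrite rcons_path => /andP[xy /andP[_ /andP[_ lx]]].
have yE := parent_rel_lt xy (mem y _); have lE : par x = last z t.
  by apply: parent_rel_lt; [rewrite parent_rel_sym|apply: mem; rewrite 2!in_cons mem_last !orbT].
move: U; rewrite /= => /and3P[_ + _]; rewrite (_ : y = last z t) ?mem_last //.
by apply: val_inj; rewrite /= -yE // !inE eqxx orbT.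
Qed.
End ParentTree.

Section DoubleBroom.
Variables n c : nat.
Hypotheses (c_ge3 : (3 <= c)%N) (c_le : (c <= n)%N).
Let a := (n - c)./2.

(* The path [0, ..., c - 1], with [a] leaves at [0] and the others at [c - 1]. *)
Definition broom_parent (x : 'I_n) : nat :=
  if (x < c)%N then x.-1 else if (x < c + a)%N then 0%N else c.-1.

Definition broom : rel 'I_n := parent_rel broom_parent.

Lemma broom_parent_lt (x : 'I_n) : (0 < x)%N -> (broom_parent x < x)%N.
Proof. by rewrite /broom_parent; case: (ltnP x c) => xc; [|case: (ltnP x (c + a))]; lia. Qed.

Lemma broom_tree : is_tree broom.
Proof. exact: parent_rel_tree broom_parent_lt. Qed.

Lemma broom_parent_path (x : 'I_n) : (broom_parent x < c)%N.
Proof. by rewrite /broom_parent; case: (ltnP x c) => xc; [|case: (ltnP x (c + a))]; lia. Qed.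

Let n_gt0 : (0 < n)%N. Proof. lia. Qed.
Let c1_lt : (c.-1 < n)%N. Proof. lia. Qed.
Definition broom_source : 'I_n := Ordinal n_gt0.
Definition broom_target : 'I_n := Ordinal c1_lt.

Lemma broom_ends : broom_source != broom_target /\ ~~ broom broom_source broom_target.
Proof.
split; first by rewrite -val_eqE /=; lia.
rewrite /broom /parent_rel /= /broom_parent /=.
have -> : (c.-1 < c)%N by lia.
by lia.
Qed.

Definition anchor (x : 'I_n) : nat := if (x < c)%N then x : nat else broom_parent x.
Definition leaf (x : 'I_n) : nat := (c <= x)%N.

Lemma anchor_lt x : (anchor x < c)%N.
Proof. by rewrite /anchor; case: (ltnP x c) => // _; exact: broom_parent_path. Qed.

Lemma anchor_adj x y : broom x y -> (anchor x <= (anchor y).+1)%N.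
Proof.
have aux (z w : 'I_n) : (0 < z)%N && (broom_parent z == w) ->
    anchor w = w /\ (anchor z = w \/ anchor z = w.+1).
  move=> /andP[z0 /eqP E]; have wc := broom_parent_path z; rewrite E in wc.
  rewrite /anchor wc; split=> //; rewrite E; case: (ltnP z c) => zc; [right|left] => //.
  by move: E; rewrite /broom_parent zc; lia.
by case/orP => /aux [-> []] ->; lia.
Qed.

Variable D : 'I_n -> 'I_n -> nat.
Hypothesis tmD : tree_metric broom D.

Lemma anchor_dist x y : (anchor x <= anchor y + D x y)%N.
Proof.
have [m] := ubnP (D x y); elim: m x => // m IH x xm.
have [->|xy] := eqVneq x y; first by rewrite (tm_xx tmD) addn0.
have [z xz zE] := tm_step tmD xy.
by have := anchor_adj xz; have := IH z; lia.
Qed.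

(** [anchor] grows by at most one across an edge, which bounds the distance from below; walking
    along the path bounds it from above. *)
Lemma path_dist (x y : 'I_n) : (x < c)%N -> (y < c)%N -> D x y = ((x - y) + (y - x))%N.
Proof.
move=> xc yc; have axE : anchor x = x by rewrite /anchor xc.
have ayE : anchor y = y by rewrite /anchor yc.
have := anchor_dist x y; have := anchor_dist y x; rewrite (tm_sym tmD y) axE ayE.
suff up (z w : 'I_n) : (z <= w)%N -> (w < c)%N -> (D z w <= w - z)%N.
  have [xy|yx] := leqP x y; first by have := up x y xy yc; lia.
  by have := up y x (ltnW yx) xc; rewrite (tm_sym tmD); lia.
move=> zw wc; have [k] : exists k, w = (z + k)%N :> nat by exists (w - z)%N; rewrite subnKC.
elim: k w wc {zw} => [|k IH] w wc wE.
  by rewrite (_ : z = w) ?(tm_xx tmD) //; apply: ord_inj; rewrite wE addn0.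
have w'n : (z + k < n)%N by have := ltn_ord w; lia.
have := IH (Ordinal w'n); rewrite /= => /(_ _ erefl).
have ww' : broom w (Ordinal w'n).
  by rewrite /broom /parent_rel /broom_parent wc /=; lia.
by have := tm_edge tmD z ww'; rewrite ![D _ z](tm_sym tmD) /=; lia.
Qed.

Lemma leaf_dist (x y z : 'I_n) : (c <= x)%N -> x != y -> z = broom_parent x :> nat ->
  D x y = (D z y).+1.
Proof.
move=> cx xy zE; have [w xw ->] := tm_step tmD xy.
have -> // : z = w; apply: ord_inj; rewrite zE; case/orP: xw => /andP[_ /eqP //].
by move=> E; have := broom_parent_path w; rewrite E ltnNge cx.
Qed.

Lemma broom_dist x y : x != y ->
  D x y = (leaf x + leaf y + (anchor x - anchor y) + (anchor y - anchor x))%N.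
Proof.
have pn z : (broom_parent z < n)%N := leq_trans (broom_parent_path z) c_le.
have half (z w : 'I_n) : z != w -> (w < c)%N ->
    D z w = (leaf z + (anchor z - w) + (w - anchor z))%N.
  move=> zw wc; rewrite /leaf /anchor; case: (ltnP z c) => zc.
    by rewrite path_dist //; lia.
  by rewrite (leaf_dist (z := Ordinal (pn z)) zc zw) // path_dist ?broom_parent_path //=; lia.
move=> xy; have [yc|yc] := ltnP y c.
  have ya : anchor y = y by rewrite /anchor yc.
  have ly : leaf y = 0%N by rewrite /leaf leqNgt yc.
  by rewrite half // ya ly; lia.
have yx : y != x by rewrite eq_sym.
have ya : anchor y = broom_parent y by rewrite /anchor ltnNge yc.
have ly : leaf y = 1%N by rewrite /leaf yc.
rewrite (tm_sym tmD) (leaf_dist (z := Ordinal (pn y)) yc yx) // (tm_sym tmD).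
(* [half] asks for distinct vertices, so the case where [y] hangs from [x] is treated apart. *)
have xp : x != Ordinal (pn y) \/ x = Ordinal (pn y) by case: eqVneq; [right|left].
rewrite ya ly.
case: xp => [xp|xE]; first by rewrite half ?broom_parent_path //=; lia.
have xv : x = broom_parent y :> nat by rewrite xE.
have xc : (x < c)%N by rewrite xv broom_parent_path.
by rewrite -xE (tm_xx tmD) /leaf /anchor xc -xv; lia.
Qed.

Let u := broom_source.
Let v := broom_target.

Lemma broom_pos_height x :
  [/\ D u v = c.-1, pos D u v x = anchor x & height D u v x = leaf x].
Proof.
have au : anchor u = 0%N by rewrite /anchor /= (leq_trans _ c_ge3).
have av : anchor v = c.-1 by rewrite /anchor /=; case: (ltnP c.-1 c) => //; lia.
have lu : leaf u = 0%N by rewrite /leaf /=; lia.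
have lv : leaf v = 0%N by rewrite /leaf /=; lia.
have [uv _] := broom_ends; have uvE := broom_dist uv; rewrite au av lu lv in uvE.
have Du : D x u = (leaf x + anchor x)%N.
  have [->|xu] := eqVneq x u; first by rewrite (tm_xx tmD) au lu.
  by rewrite broom_dist // au lu; lia.
have Dv : D x v = (leaf x + (c.-1 - anchor x))%N.
  have [->|xv] := eqVneq x v; first by rewrite (tm_xx tmD) av lv; lia.
  by rewrite broom_dist // av lv; have := anchor_lt x; lia.
have := anchor_lt x; rewrite /pos /height uvE Du Dv; split; lia.
Qed.

Lemma broom_excess (R : realType) : metric_excess R D u v = 0.
Proof.
rewrite /metric_excess big1 // => x _; rewrite big1 // => y yx.
have [_ -> ->] := broom_pos_height x; have [_ -> ->] := broom_pos_height y.
rewrite broom_dist 1?eq_sym // !natrD.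
have [xy|yx'] := leqP (anchor x) (anchor y).
  have -> : (anchor x - anchor y = 0)%N by lia.
  rewrite distrC natrB // ger0_norm ?subr_ge0 ?ler_nat //; ring.
have -> : (anchor y - anchor x = 0)%N by lia.
by rewrite natrB 1?ltnW // ger0_norm ?subr_ge0 ?ler_nat 1?ltnW //; ring.
Qed.

Lemma broom_leaves (y : 'I_n) : height D u v y != 0%N ->
  pos D u v y = if (y < c + a)%N then 0%N else c.-1.
Proof.
have [_ -> ->] := broom_pos_height y; rewrite /leaf /anchor /broom_parent.
by case: (ltnP y c).
Qed.

Lemma broom_card :
  #|[pred y : 'I_n | height D u v y != 0%N & (y < c + a)%N]| = ((n - c)./2)%N.
Proof.
have an : (c + a <= n)%N by rewrite /a; lia.
have count k : (\sum_(i < k) ((c <= i) && (i < c + a)) = minn k (c + a) - c)%N.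
  elim: k => [|k IH]; first by rewrite big_ord0 min0n.
  rewrite big_ord_recr /= IH.
  by case: (leqP c k) => ?; case: (ltnP k (c + a)) => ? /=; lia.
transitivity (\sum_(y < n) ((c <= y) && (y < c + a)))%N; last by rewrite count /a; lia.
rewrite -sum1_card big_mkcond /=; apply: eq_bigr => y _.
rewrite inE; have [_ _ ->] := broom_pos_height y; rewrite /leaf.
by case: (c <= y)%N; case: (y < c + a)%N.
Qed.
End DoubleBroom.

(** * Lower bound for a given cycle length, and the double brooms attaining it *)

Lemma geodesic_bounds n (e : rel 'I_n) (D : 'I_n -> 'I_n -> nat) (u v : 'I_n) :
  tree_metric e D -> u != v -> ~~ e u v -> (3 <= (D u v).+1 <= n)%N.
Proof.
move=> tmD uv nuv; apply/andP; split; last first.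
  have surj (i : 'I_(D u v).+1) : {x | pos D u v x = i}.
    by apply: cid; have [|x] := pos_surj tmD (u := u) (v := v) (i := i); [rewrite -ltnS|exists x].
  rewrite -[(D u v).+1]card_ord -[leqRHS]card_ord.
  apply: (@leq_card _ _ (fun i => sval (surj i))) => i j ij; apply: ord_inj.
  by rewrite -(svalP (surj i)) -(svalP (surj j)) ij.
rewrite ltnNge ltnS; apply/negP => le1.
have [z uz zE] := tm_step tmD uv; have zv : z = v by apply: (tm_eq0 tmD); lia.
by rewrite zv (negPf nuv) in uz.
Qed.

Section CycleClosingCost.
Variables (R : realType) (n : nat) (e : rel 'I_n) (D : 'I_n -> 'I_n -> nat).
Variables u v : 'I_n.
Hypotheses (tmD : tree_metric e D) (uv : u != v) (nuv : ~~ e u v).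
Let m : R := n%:R.
Let kappa : R := (m - 1) / (D u v).+1%:R.
Let p := pos D u v.

(** Three times [kemeny_diff], with the extremal spread added and subtracted. Both corrections to
    [f_parity] are nonnegative and vanish for the double broom. *)
Lemma kemeny_diff_spread :
  6 * m * (m - 1) * (kemeny R (add_edge e u v) - kemeny R e) =
  f_parity R n (D u v).+1 + 6 * metric_excess R D u v +
  6 * (max_spread kappa n (D u v) - \sum_x \sum_y spread kappa (p x) (p y)).
Proof.
have /andP[_ cn] := geodesic_bounds tmD uv nuv.
have := kemeny_diff R tmD uv nuv; rewrite -/m -(max_spreadE R cn) -/m -/kappa.
have -> : \sum_x \sum_y spread kappa (p x) (p y) =
    \sum_x \sum_y `|(p x)%:R - (p y)%:R| +
    kappa * \sum_x \sum_y ((p x)%:R - (p y)%:R) ^+ 2.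
  rewrite mulr_sumr -big_split; apply: eq_bigr => x _.
  by rewrite mulr_sumr -big_split.
rewrite -/p [_ * (\sum_x _) / _]mulrAC -/kappa.
move: (\sum_x \sum_y _ ^+ 2) (\sum_x \sum_y `|_|) (max_spread _ _ _) (metric_excess _ _ _ _).
move: (kemeny R (add_edge e u v) - kemeny R e) ((D u v).+1%:R : R) => d c a b M X E.
have -> : 6 * m * (m - 1) * d = 3 * (2 * m * (m - 1) * d) by ring.
by rewrite E; ring.
Qed.
End CycleClosingCost.

Theorem theorem4p2 (R : realType) (n : nat) (hn : (23 <= n)%N) :
  (forall (T : rel 'I_n) (u v : 'I_n), is_tree T -> u != v -> ~~ T u v ->
     claimed_min R n <= kemeny R (add_edge T u v) - kemeny R T) /\
  (exists (T : rel 'I_n) (u v : 'I_n),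
     [/\ is_tree T, u != v, ~~ T u v &
         kemeny R (add_edge T u v) - kemeny R T = claimed_min R n]).
Proof.
have den0 := denom_gt0 R hn.
have kappa_ge0 c : 0 <= (n%:R - 1) / c.+1%:R :> R.
  by rewrite divr_ge0 // subr_ge0 (ler_nat R 1); apply: leq_trans hn.
split=> [T u v treeT uv nuv|].
  have tmD := is_tree_metric treeT.
  have bounds := geodesic_bounds tmD uv nuv.
  apply: le_trans (claimed_min_le R hn bounds) _.
  rewrite ler_pdivrMr // mulrC (kemeny_diff_spread R tmD uv nuv) -addrA lerDl.
  rewrite addr_ge0 // mulr_ge0 // ?(metric_excess_ge0 R tmD) // subr_ge0.
  apply: spread_le_max => [//|x|F].
    by have [] := pos_heightP tmD u v x.
  exact: (sum_geodesic tmD).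
have [c /andP[c3 cn] ->] := claimed_min_attained R hn.
exists (broom c), (broom_source c3 cn), (broom_target c3 cn).
have treeT := broom_tree c3 cn; have tmD := is_tree_metric treeT.
have [uv nuv] := broom_ends c3 cn; split=> //.
set u := broom_source c3 cn in uv nuv *; set v := broom_target c3 cn in uv nuv *.
have [uvE _ _] := broom_pos_height c3 cn tmD u; rewrite -/u -/v in uvE.
have c1E : c.-1.+1 = c by lia.
have := kemeny_diff_spread R tmD uv nuv; rewrite (broom_excess c3 cn tmD R) mulr0 addr0.
rewrite (spread_eq_max _ (sum_geodesic tmD u v) (B := fun y => (y < c + (n - c)./2)%N)).
- rewrite subrr mulr0 addr0 uvE c1E => <-.
  by rewrite mulrAC divff ?mul1r // gt_eqF.
- by move=> y yl; rewrite (broom_leaves tmD yl) uvE.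
- by rewrite (broom_card c3 cn tmD) uvE c1E.
Qed.
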